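(* Consider the random field Ising model with Gaussian field (or with any common distribution $\nu$ of mean $0$ and variance $1$) in dimension $d\ge1$. For every $0\le\beta<\beta_P(d)$ there is a constant $C_3(\beta)\in(0,\infty)$ depending only on $\beta$ (and $d$) such that for every $H>0$, all finite subsets $\Delta\subseteq\Lambda$ of $\mathbb{Z}^d$, and every realization $\vec h\in\mathbb{R}^\Lambda$, $$\sup_{\eta,\eta'\in\{-1,+1\}^{\partial_{ex}\Lambda}}TV\left(P^{\vec h}_{\Lambda,\eta,\beta,H}(\sigma_\Delta\in\cdot),P^{\vec h}_{\Lambda,\eta',\beta,H}(\sigma_\Delta\in\cdot)\right)\le\sum_{x\in\partial_{ex}\Delta,\,y\in\partial_{ex}\Lambda}e^{-C_3(\beta)|x-y|}.$$
   Context: For a finite $\Lambda\subseteq\mathbb{Z}^d$, $\partial_{ex}\Lambda$ is the set of vertices of $\mathbb{Z}^d\setminus\Lambda$ having a nearest neighbor in $\Lambda$. For $\beta\ge0$, $H\ge 0$, $\eta\in\{-1,+1\}^{\partial_{ex}\Lambda}$ and $\vec h\in\mathbb{R}^\Lambda$, $P^{\vec h}_{\Lambda,\eta,\beta,H}$ is the probability measure on $\{-1,+1\}^\Lambda$ given by $$P^{\vec h}_{\Lambda,\eta,\beta,H}(\sigma)\propto\exp\Big[\beta\sum_{\{u,v\}}\sigma_u\sigma_v+\beta\sum_{\{u,v\}:u\in\Lambda,v\in\partial_{ex}\Lambda}\sigma_u\eta_v+H\sum_{u\in\Lambda}h_u\sigma_u\Big],$$ where the first sum is over (unordered) nearest neighbor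 pairs in $\Lambda$ and the second over nearest neighbor pairs. In the random field Ising model (RFIM), $\vec h$ is a realization of i.i.d. random variables $H_u$ with common distribution $\nu$ of mean $0$ and variance $1$; the Gaussian field has $\nu=N(0,1)$. $\sigma_\Delta$ is the restriction of $\sigma$ to $\Delta$, $TV$ is total variation distance, $|\cdot|$ is the Euclidean norm. $\beta_P(d)$ is defined by $1-e^{-2\beta_P(d)}=p_c^b(d)$, where $p_c^b(d)$ is the critical probability of independent Bernoulli bond percolation on $\mathbb{Z}^d$ (so $\beta_P(1)=\infty$). *)

(* Defs.v *)
From HB Require Import structures.
From mathcomp Require Import all_boot all_order all_algebra finmap.
From mathcomp Require Import all_classical all_reals all_analysis.

Set Implicit Arguments.
Unset Strict Implicit.
Unset Printing Implicit Defensive.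

Import Order.TTheory GRing.Theory Num.Theory.

Local Open Scope classical_set_scope.
Local Open Scope ring_scope.

Section Lattice.
Variable d : nat.

Definition site := 'rV[int]_d.

Definition unitv (i : 'I_d) : site := delta_mx 0 i.

Definition nn (u v : site) : bool :=
  [exists i, (v == u + unitv i) || (u == v + unitv i)].

Definition nbrs (u : site) : {fset site} :=
  ([fset (u + unitv i)%R | i : 'I_d] `|` [fset (u - unitv i)%R | i : 'I_d])%fset.

Definition exbd (L : {fset site}) : {fset site} :=
  ((\bigcup_(u <- L) nbrs u) `\` L)%fset.

Definition eucl_dist (R : rcfType) (x y : site) : R :=
  Num.sqrt (\sum_(i < d) ((x 0 i - y 0 i)%:~R ^+ 2)).

Lemma in_nbrs u v : (v \in nbrs u) = nn u v.
Proof.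
rewrite /nbrs inE; apply/orP/existsP.
  case=> /imfsetP[i _ ->]; exists i; first by rewrite eqxx.
  by rewrite subrK eqxx orbT.
case=> i /orP[] /eqP ->; [left|right]; apply/imfsetP; exists i => //=.
by rewrite addrK.
Qed.

Lemma in_exbd (L : {fset site}) v :
  (v \in exbd L) = (v \notin L) && [exists u : L, nn (val u) v].
Proof.
rewrite /exbd in_fsetD; congr (_ && _).
apply/bigfcupP/existsP => [[u /andP[uL _]]|[u uv]].
  by rewrite in_nbrs => uv; exists [` uL]%fset.
by exists (val u); rewrite ?in_nbrs ?fsvalP.
Qed.

(* The bond (x, i) joins x and x + e_i, so that every unordered nearest
   neighbour pair is represented exactly once. *)
Definition bond := (site * 'I_d)%type.

Definition config := bond -> bool.

Definition open_edge (w : config) (u v : site) : bool :=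
  [exists i, ((v == u + unitv i) && w (u, i))
          || ((u == v + unitv i) && w (v, i))].

Definition cluster (w : config) (x : site) : set site :=
  [set y | exists s : seq site, path (open_edge w) x s /\ last x s = y].

Definition cylinders : set (set config) :=
  [set [set w : config | w e] | e in [set: bond]].

(* {0,1}^bonds with the product sigma-algebra *)
Definition configs := g_sigma_algebraType cylinders.

End Lattice.

Section BondPercolation.
Variables (R : realType) (d : nat).

Definition is_bernoulli_percolation (p : R) (P : probability (configs d) R) :=
  forall (F : {fset bond d}) (t : config d),
    P [set w | forall e, e \in F -> w e = t e] =
    (\prod_(e <- F) (if t e then p else 1 - p))%:E.

(* p_c = sup {p : theta(p) = 0}.  The Bernoulli law with parameter p exists
   and is unique (its values on cylinders are prescribed), so the existential
   quantifier below only names it. *)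
Definition pc_bond : R :=
  sup [set p : R | 0 <= p <= 1 /\
    exists P : probability (configs d) R, is_bernoulli_percolation p P /\
      P [set w | infinite_set (cluster w 0)] = 0%E].

(* Solution in [0, +oo] of 1 - exp(-2 beta_P) = p_c, see betaP_eq and betaP_ge0; it is +oo
   when p_c = 1. *)
Definition betaP : \bar R := ((2^-1)%:E * - lne (1 - pc_bond)%:E)%E.

Lemma pc_bond_ge0_le1 : 0 <= pc_bond <= 1.
Proof.
rewrite /pc_bond; set A := [set p | _].
have [->|/set0P[p Ap]] := eqVneq A set0; first by rewrite sup0 lexx ler01.
have ubA : ubound A 1 by move=> q [/andP[]].
apply/andP; split; last by apply: ge_sup => //; exists p.
have [/andP[p0 _] _] := Ap.
by apply: le_trans p0 _; apply: ub_le_sup => //; exists 1.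
Qed.

Lemma betaP_eq : (1 - expeR (- 2%:E * betaP) = pc_bond%:E)%E.
Proof.
have /andP[_ p1] := pc_bond_ge0_le1.
have -> : (- 2%:E * betaP = lne (1 - pc_bond)%:E)%E.
  rewrite /betaP muleA -EFinN -EFinM mulNr divff ?pnatr_eq0//.
  by rewrite EFinN mulN1e oppeK.
have /eqP -> : expeR (lne (1 - pc_bond)%:E) == (1 - pc_bond)%:E.
  by rewrite lneK_eq lee_fin subr_ge0.
by rewrite -EFinB opprB addrC subrK.
Qed.

Lemma betaP_ge0 : (0 <= betaP)%E.
Proof.
have /andP[p0 _] := pc_bond_ge0_le1.
rewrite /betaP mule_ge0 ?lee_fin ?invr_ge0// oppe_ge0 lne_le0 lee_fin.
by rewrite gerBl.
Qed.

End BondPercolation.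

Section Ising.
Variables (R : realType) (d : nat).

(* true = +1, false = -1 *)
Definition spin (b : bool) : R := if b then 1 else -1.

Definition spins (L : {fset site d}) := {ffun L -> bool}.

(* The factor 2^-1 compensates for the fact that every unordered nearest
   neighbour pair of L is met twice in the first double sum. *)
Definition gibbs_exponent (L : {fset site d}) (eta : spins (exbd L))
    (beta H : R) (h : L -> R) (s : spins L) : R :=
  beta * (2^-1 * \sum_(u : L) \sum_(v : L | nn (val u) (val v))
                    spin (s u) * spin (s v))
  + beta * (\sum_(u : L) \sum_(v : exbd L | nn (val u) (val v))
              spin (s u) * spin (eta v))
  + H * \sum_(u : L) h u * spin (s u).

Definition gibbs (L : {fset site d}) (eta : spins (exbd L)) (beta H : R)
    (h : L -> R) (s : spins L) : R :=
  expR (gibbs_exponent eta beta H h s) /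
  \sum_(s' : spins L) expR (gibbs_exponent eta beta H h s').

Definition restrict (D L : {fset site d}) (DL : (D `<=` L)%fset)
    (s : spins L) : spins D := [ffun x : D => s (fincl DL x)].

(* probability mass function of the restriction to D under the measure gibbs *)
Definition gibbs_marginal (D L : {fset site d}) (DL : (D `<=` L)%fset)
    (eta : spins (exbd L)) (beta H : R) (h : L -> R) (t : spins D) : R :=
  \sum_(s : spins L | restrict DL s == t) gibbs eta beta H h s.

(* p and q are probability mass functions; the maximum over all events of
   |p(A) - q(A)| *)
Definition tv_dist (T : finType) (p q : T -> R) : R :=
  \big[Num.max/0]_(A : {set T}) `|\sum_(x in A) p x - \sum_(x in A) q x|.

End Ising.

(* Main.v *)
(** Disagreement percolation.  A nearest neighbour interaction exp(beta s_u s_v) equals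
    exp(beta) times (1 - p) + p [s_u = s_v] with p = 1 - exp(- 2 beta).  Hence, when v is
    pinned, the Gibbs measure is (1 - p) times the measure without the bond uv plus
    p times a mixture of the measures where u is pinned too.  Revealing in this way the
    bonds that touch the pinned region, for two boundary conditions at once, the two laws can
    only differ on D if D is connected to the outside of L by open bonds of Bernoulli(p)
    percolation; the external field plays no role.  A connection from D to the boundary of L
    contains one from exbd D to exbd L, and a union bound leaves the two-point function of
    subcritical percolation, which decays exponentially.

    The decay is proved as by Duminil-Copin and Tassion.  If p * phi p S < 1 for some finite
    S containing 0, iterating the Simon-Lieb inequality gives the decay.  Otherwise Russo's
    formula yields d/dr P_r(0 <-> outside L) >= 1 - P_r(0 <-> outside L) for r >= p and every
    finite L, so that for r > p the origin is in an infinite cluster with positive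
    probability, contradicting p < p_c. *)
Require Import Defs.
From HB Require Import structures.
From mathcomp Require Import all_boot all_order all_algebra finmap.
From mathcomp Require Import all_classical all_reals all_analysis.
From mathcomp Require Import ring lra.

Set Implicit Arguments.
Unset Strict Implicit.
Unset Printing Implicit Defensive.

Import Order.TTheory GRing.Theory Num.Theory.
Import numFieldNormedType.Exports.

Local Open Scope classical_set_scope.
Local Open Scope ring_scope.

(** * Expectation under finite product measures *)

Section ProductExpectation.
Variables (R : realType) (E : eqType).
Implicit Types (q : E -> R) (s t : seq E) (e : E) (b : bool) (w : E -> bool).
Implicit Types f g : (E -> bool) -> R.

Definition upd w e b : E -> bool := fun x => if x == e then b else w x.

Lemma upd_same w e b b' : upd (upd w e b) e b' = upd w e b'.
Proof. by apply/funext => x; rewrite /upd; case: eqP. Qed.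

Lemma upd_comm w e e' b b' : e != e' ->
  upd (upd w e b) e' b' = upd (upd w e' b') e b.
Proof.
move=> ne; apply/funext => x; rewrite /upd.
by have [->|//] := eqVneq x e'; rewrite eq_sym (negbTE ne).
Qed.

Lemma upd_id w e : upd w e (w e) = w.
Proof. by apply/funext => x; rewrite /upd; case: eqP => // ->. Qed.

(* Expectation when the coordinates in [s] are independent, coordinate [e]
   being true with probability [q e], and the others are frozen to [w].  For
   percolation [w] is [xpred0], so that the bonds outside [s] are closed; for
   spins [w] is the boundary condition. *)
Fixpoint Ex q s f w : R :=
  if s is e :: s' then
    q e * Ex q s' f (upd w e true) + (1 - q e) * Ex q s' f (upd w e false)
  else f w.

Definition insens f e := forall w b, f (upd w e b) = f w.

Definition incr f := forall w w', (forall e, w e ==> w' e) -> f w <= f w'.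

Lemma Ex_ext q s f g w : f =1 g -> Ex q s f w = Ex q s g w.
Proof. by move=> fg; elim: s w => [|e s IH] w //=; rewrite !IH. Qed.

Lemma ExZ q s c f w : Ex q s (fun v => c * f v) w = c * Ex q s f w.
Proof. by elim: s w => [|e s IH] w //=; rewrite !IH; ring. Qed.

Lemma Ex_cst q s c w : Ex q s (fun=> c) w = c.
Proof. by elim: s w => [|e s IH] w //=; rewrite !IH; ring. Qed.

Lemma ExB q s f g w : Ex q s (fun v => f v - g v) w = Ex q s f w - Ex q s g w.
Proof. by elim: s w => [|e s IH] w //=; rewrite !IH; ring. Qed.

Lemma Ex_sum q s (I : Type) (r : seq I) (P : pred I) (F : I -> (E -> bool) -> R) w :
  Ex q s (fun v => \sum_(i <- r | P i) F i v) w = \sum_(i <- r | P i) Ex q s (F i) w.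
Proof.
elim: s w => [|e s IH] w //=.
by rewrite !IH !mulr_sumr -big_split.
Qed.

Definition is_prob q := forall e, 0 <= q e <= 1.

Lemma Ex_le q s f g w : is_prob q -> (forall v, f v <= g v) ->
  Ex q s f w <= Ex q s g w.
Proof.
move=> q01 fg; elim: s w => [|e s IH] w //=.
have /andP[q0 q1] := q01 e.
by apply: lerD; apply: ler_wpM2l; rewrite ?subr_ge0.
Qed.

Lemma Ex_ge0 q s f w : is_prob q -> (forall v, 0 <= f v) -> 0 <= Ex q s f w.
Proof. by move=> q01 f0; rewrite -(Ex_cst q s 0 w); exact: Ex_le. Qed.

Lemma Ex_insens q s f e b w : insens f e -> Ex q s f (upd w e b) = Ex q s f w.
Proof.
move=> fe; elim: s w => [|e' s IH] w //=.
have [->|ne] := eqVneq e e'; first by rewrite !upd_same.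
by rewrite !(upd_comm _ _ _ ne) !IH.
Qed.

Lemma Ex_skip q s f e w : insens f e -> Ex q (e :: s) f w = Ex q s f w.
Proof. by move=> fe /=; rewrite !Ex_insens//; ring. Qed.

(** Independence in a pointwise form: each coordinate of [s] is seen by at most one of the two
    factors, so the other factor can be pulled out when that coordinate is integrated. *)
Lemma Ex_indep q s f g w : (forall e, e \in s -> insens f e \/ insens g e) ->
  Ex q s (fun v => f v * g v) w = Ex q s f w * Ex q s g w.
Proof.
elim: s w => [|e s IH] w //= fg.
rewrite !IH; try by move=> e' e's; apply: fg; rewrite inE e's orbT.
have [fe|ge] := fg e (mem_head _ _).
  by rewrite !(Ex_insens _ _ _ _ fe); ring.
by rewrite !(Ex_insens _ _ _ _ ge); ring.
Qed.

Lemma Ex_upd q s f e b w : e \notin s ->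
  Ex q s f (upd w e b) = Ex q s (fun v => f (upd v e b)) w.
Proof.
elim: s w => [|e' s IH] w //=; rewrite inE negb_or => /andP[ne es].
by rewrite !(upd_comm _ _ _ ne) !IH.
Qed.

Lemma Ex_swap q s f e e' w : Ex q (e :: e' :: s) f w = Ex q (e' :: e :: s) f w.
Proof.
have [->//|ne] := eqVneq e e'.
by rewrite /= !(upd_comm _ _ _ ne); ring.
Qed.

Lemma Ex_perm q s t f w : perm_eq s t -> Ex q s f w = Ex q t f w.
Proof.
elim: s t w => [|e s IH] t w st; first by have := perm_size st; case: t st.
have et : e \in t by rewrite -(perm_mem st) mem_head.
case/splitPr: et st => t1 t2.
rewrite -[t1 ++ e :: t2]/(t1 ++ [:: e] ++ t2) perm_sym perm_catCA /= perm_cons.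
rewrite perm_sym => st; transitivity (Ex q (e :: t1 ++ t2) f w).
  by rewrite /= !(IH _ _ st).
elim: t1 {st IH} w => [//|e' t1 IH] w.
by rewrite [(e' :: t1) ++ t2]cat_cons Ex_swap /= -!IH.
Qed.

Lemma Ex_filter q s f (P : pred E) w :
  (forall e, e \in s -> ~~ P e -> insens f e) ->
  Ex q s f w = Ex q [seq e <- s | P e] f w.
Proof.
elim: s w => [//|e s IH] w fP.
have {}IH w' : Ex q s f w' = Ex q [seq e <- s | P e] f w'.
  by apply: IH => e' e's; apply: fP; rewrite inE e's orbT.
have [Pe|Pe] := boolP (P e); first by rewrite /= Pe /= !IH.
by rewrite Ex_skip ?IH /= ?(negbTE Pe)//; apply: fP; rewrite ?mem_head.
Qed.

Lemma Ex_incr q s f w w' : is_prob q -> incr f -> (forall e, w e ==> w' e) ->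
  Ex q s f w <= Ex q s f w'.
Proof.
move=> q01 fi; elim: s w w' => [|e s IH] w w' ww' /=; first exact: fi.
have /andP[q0 q1] := q01 e.
by apply: lerD; apply: ler_wpM2l; rewrite ?subr_ge0//; apply: IH => e'; rewrite /upd;
  case: ifP.
Qed.

Lemma upd_le w e b b' : b ==> b' -> forall e', upd w e b e' ==> upd w e b' e'.
Proof. by move=> bb e'; rewrite /upd; case: ifP => // _; rewrite implybb. Qed.

(** Raising [q e] moves mass from the closed to the open branch of the recursion, and the open
    branch has the larger expectation. *)
Lemma Ex_incr_p q q' s f w : is_prob q -> is_prob q' -> (forall e, q e <= q' e) ->
  incr f -> Ex q s f w <= Ex q' s f w.
Proof.
move=> q01 q'01 qq fi; elim: s w => [//|e s IH] w /=.
have /andP[q0 q1] := q01 e; have /andP[q'0 q'1] := q'01 e.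
have := IH (upd w e true); have := IH (upd w e false).
have : Ex q' s f (upd w e false) <= Ex q' s f (upd w e true).
  by apply: Ex_incr => //; exact: upd_le.
have := qq e.
set a := Ex _ _ _ _; set b := Ex _ _ _ _.
set c := Ex _ _ _ _; set d := Ex _ _ _ _ => h1 h2 h3 h4.
have : q e * d + (1 - q e) * c <= q e * b + (1 - q e) * a.
  by apply: lerD; apply: ler_wpM2l => //; rewrite ?subr_ge0.
have : 0 <= (q' e - q e) * (b - a) by rewrite mulr_ge0 ?subr_ge0.
lra.
Qed.

Lemma Ex_incr_filter q s f (P : pred E) : is_prob q -> incr f ->
  Ex q [seq e <- s | P e] f xpred0 <= Ex q s f xpred0.
Proof.
(* The induction changes [w] at the retained coordinates, so only the dropped ones are required to
   be false. *)
move=> q01 fi; suff : forall w, (forall e, ~~ P e -> w e = false) ->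
  Ex q [seq e <- s | P e] f w <= Ex q s f w by apply.
elim: s => [//|e s IH] w wP /=.
have /andP[q0 q1] := q01 e; case: ifPn => Pe /=.
  have updP b e' : ~~ P e' -> upd w e b e' = false.
    by move=> Pe'; rewrite /upd; case: eqP => [e'e|_]; [rewrite e'e Pe in Pe'|exact: wP].
  by apply: lerD; apply: ler_wpM2l; rewrite ?subr_ge0//; apply: IH => e'; exact: updP.
have we : upd w e false = w by rewrite -(wP _ Pe) upd_id.
apply: le_trans (IH _ wP) _; rewrite we.
have : Ex q s f w <= Ex q s f (upd w e true).
  by rewrite -{1}we; apply: Ex_incr => //; exact: upd_le.
by move=> h; have := mulr_ge0 q0 (etrans (subr_ge0 _ _) h); lra.
Qed.

(** Coordinates of [s] outside [t] integrate out, and coordinates of [t] outside [s] only help an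
    increasing function. This replaces any bond list by one containing every relevant bond. *)
Lemma Ex_incl q s t f : is_prob q -> incr f -> uniq s -> uniq t ->
  (forall e, e \notin t -> insens f e) -> Ex q s f xpred0 <= Ex q t f xpred0.
Proof.
move=> q01 fi us ut ft.
rewrite (@Ex_filter q s f (mem t)); last by move=> e _; exact: ft.
apply: le_trans (@Ex_incr_filter q t f (mem s) q01 fi).
rewrite le_eqVlt (@Ex_perm q _ [seq x <- t | mem s x]) ?eqxx//.
apply: uniq_perm; rewrite ?filter_uniq// => e.
by rewrite !mem_filter /= andbC.
Qed.

(** Serves to compare two boundary conditions: both systems share the coordinates in [s], and each
    keeps its own frozen values elsewhere. *)
Lemma Ex_dep q s f g w w' :
  (forall v v', {in s, v =1 v'} -> (forall e, e \notin s -> v e = w e) ->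
     (forall e, e \notin s -> v' e = w' e) -> f v = g v') ->
  Ex q s f w = Ex q s g w'.
Proof.
elim: s w w' => [|e s IH] w w' fg /=; first exact: fg.
suff H b : Ex q s f (upd w e b) = Ex q s g (upd w' e b) by rewrite !H.
apply: IH => v v' vv' vw vw'; apply: fg => e'.
- rewrite inE => /predU1P[->|]; last exact: vv'.
  have [es|es] := boolP (e \in s); first exact: vv'.
  by rewrite vw// vw'// /upd eqxx.
- by rewrite inE negb_or => /andP[ne es]; rewrite vw// /upd (negbTE ne).
- by rewrite inE negb_or => /andP[ne es]; rewrite vw'// /upd (negbTE ne).
Qed.

(** Russo's formula for arbitrary functions. By the product rule the head coordinate contributes the
    difference of its two branches, and the tail contributes the induction hypothesis in each
    branch. *)
Lemma Ex_derive s f w (x : R) : uniq s ->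
  is_derive x 1 (fun p : R => Ex (fun=> p) s f w)
    (\sum_(e <- s) Ex (fun=> x) s (fun v => f (upd v e true) - f (upd v e false)) w).
Proof.
elim: s w => [|e s IH] w /= => [_|/andP[es us]].
  by rewrite big_nil; exact: is_derive_cst.
have Hid : is_derive x 1 (@id R) 1 by exact: is_derive_id.
have H1 := @is_deriveM _ _ _ _ x 1 _ _ Hid (IH (upd w e true) us).
have H0 := @is_deriveM _ _ _ _ x 1 _ _
  (is_deriveB (is_derive_cst (1 : R) x 1) Hid) (IH (upd w e false) us).
have := is_deriveD H1 H0.
set D := (X in is_derive _ _ _ X) => HD.
set D' := (X in is_derive _ _ _ X).
suff <- : D = D' by exact: HD.
rewrite /D /D' big_cons /=.
pose S b := \sum_(j <- s)
  Ex (fun=> x) s (fun v => f (upd v j true) - f (upd v j false)) (upd w e b).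
rewrite [X in _ = _ + X](_ : _ = x * S true + (1 - x) * S false); last first.
  by rewrite big_split /= -!mulr_sumr.
have ins : insens (fun v => f (upd v e true) - f (upd v e false)) e.
  by move=> v b; rewrite !upd_same.
rewrite !(Ex_insens _ _ _ _ ins) ExB -!(Ex_upd _ _ _ _ es).
rewrite /GRing.scale /= /cst /=.
rewrite /S -[((fun=> 1) - id) x]/(1 - x); ring.
Qed.

Lemma Ex_map (phi psi : E -> E) (p : R) s f w : cancel phi psi -> cancel psi phi ->
  Ex (fun=> p) (map phi s) f (w \o psi) = Ex (fun=> p) s (fun v => f (v \o psi)) w.
Proof.
move=> phiK psiK; elim: s w => [//|e s IH] w /=.
have E1 b : upd (w \o psi) (phi e) b = upd w e b \o psi.
  by apply/funext => x; rewrite /upd /= (can2_eq psiK phiK).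
by rewrite !E1 !IH.
Qed.

End ProductExpectation.

(** * Indicators of propositional events *)

Section Indicator.
Variable R : realType.

Definition ind (P : Prop) : R := (`[< P >])%:R.

Lemma ind_ge0 P : 0 <= ind P. Proof. exact: ler0n. Qed.

Lemma ind_le1 P : ind P <= 1. Proof. by rewrite /ind lern1; case: asbool. Qed.

Lemma indT (P : Prop) : P -> ind P = 1.
Proof. by move=> p; rewrite /ind (introT (asboolP _) p). Qed.

Lemma indF (P : Prop) : ~ P -> ind P = 0.
Proof. by move=> p; rewrite /ind (introF (asboolP _) p). Qed.

Lemma ind_le (P Q : Prop) : (P -> Q) -> ind P <= ind Q.
Proof.
move=> PQ; have [p|np] := pselect P; last by rewrite (indF np) ind_ge0.
by rewrite (indT (PQ p)) ind_le1.
Qed.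

Lemma ind_iff (P Q : Prop) : (P <-> Q) -> ind P = ind Q.
Proof. by move=> [PQ QP]; apply/eqP; rewrite eq_le !ind_le. Qed.

End Indicator.
Arguments ind {R} P.
Arguments indT {R P} _.
Arguments indF {R P} _.

(** * Connections in the lattice *)

Section Connectivity.
Variable d : nat.
Implicit Types (w : config d) (e : bond d) (x y u v : site d) (U S : {fset site d}).

Definition tgt e : site d := e.1 + unitv e.2.

Definition joins e u v : bool :=
  ((u == e.1) && (v == tgt e)) || ((v == e.1) && (u == tgt e)).

Lemma joinsC e u v : joins e u v = joins e v u.
Proof. by rewrite /joins orbC. Qed.

Lemma open_edgeP w u v : reflect (exists2 e, joins e u v & w e) (open_edge w u v).
Proof.
apply: (iffP existsP) => [[i /orP[]/andP[/eqP-> we]]|[[a i] /orP[]/andP[/eqP-> /eqP->] we]].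
- by exists (u, i) => //; rewrite /joins /tgt !eqxx.
- by exists (v, i) => //; rewrite /joins /tgt !eqxx orbT.
- by exists i; rewrite eqxx we.
- by exists i; rewrite eqxx we orbT.
Qed.

Lemma nnP u v : reflect (exists e, joins e u v) (nn u v).
Proof.
apply: (iffP existsP) => [[i /orP[]/eqP->]|[[a i] /orP[]/andP[/eqP-> /eqP->]]].
- by exists (u, i); rewrite /joins /tgt !eqxx.
- by exists (v, i); rewrite /joins /tgt !eqxx orbT.
- by exists i; rewrite eqxx.
- by exists i; rewrite eqxx orbT.
Qed.

Lemma open_edge_le w w' u v : (forall e, w e ==> w' e) -> open_edge w u v -> open_edge w' u v.
Proof.
move=> ww' /open_edgeP[e j we]; apply/open_edgeP; exists e => //.
exact: implyP (ww' e) we.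
Qed.

Lemma unitv_neq0 (i : 'I_d) : unitv i != 0.
Proof. by apply/eqP => /matrixP/(_ 0 i); rewrite !mxE !eqxx. Qed.

(** Two bonds over the same pair have the same orientation, because no sum of two unit vectors
    vanishes; equal directions follow. *)
Lemma joins_inj e e' u v : joins e u v -> joins e' u v -> e = e'.
Proof.
have unitv_sum (i j : 'I_d) : unitv i + unitv j != 0 :> site d.
  apply/eqP => /matrixP/(_ 0 i); rewrite !mxE !eqxx /=.
  by case: (i == j).
have unitv_inj (i j : 'I_d) : unitv i = unitv j -> i = j.
  by move=> /matrixP/(_ 0 i); rewrite !mxE !eqxx /=; case: eqP.
case: e e' => [a i] [b j]; rewrite /joins /tgt /=.
move=> /orP[]/andP[/eqP-> /eqP->] /orP[]/andP[/eqP E1 /eqP E2].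
- by move: E2; rewrite E1 => /addrI/unitv_inj ->.
- move: E2; rewrite -E1 -addrA -[X in X = _]addr0 => /addrI/esym/eqP.
  by rewrite (negbTE (unitv_sum _ _)).
- move: E2; rewrite -E1 -addrA -[X in X = _]addr0 => /addrI/esym/eqP.
  by rewrite (negbTE (unitv_sum _ _)).
- by move: E2; rewrite E1 => /addrI/unitv_inj ->.
Qed.

(** Inductive forms of open paths: [conn] keeps every vertex in [U], whereas [exits] asks only for
    some endpoint off [U], so that a path may be stopped at its first vertex off [U]. *)
Inductive conn w U : site d -> site d -> Prop :=
| conn_refl x : x \in U -> conn w U x x
| conn_step x y z : x \in U -> open_edge w x y -> conn w U y z -> conn w U x z.

Inductive exits w U : site d -> Prop :=
| exits_out x : x \notin U -> exits w U x
| exits_step x y : open_edge w x y -> exits w U y -> exits w U x.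

Lemma conn_l w U x y : conn w U x y -> x \in U.
Proof. by case. Qed.

Lemma conn_r w U x y : conn w U x y -> y \in U.
Proof. by elim. Qed.

Lemma conn_le w w' U U' x y : (forall e, w e ==> w' e) -> {subset U <= U'} ->
  conn w U x y -> conn w' U' x y.
Proof.
move=> ww' UU'; elim=> {x y} [x xU|x y z xU xy _ IH]; first exact/conn_refl/UU'.
by apply: conn_step IH; [exact: UU'|exact: open_edge_le xy].
Qed.

Lemma exits_le w w' U U' x : (forall e, w e ==> w' e) -> {subset U' <= U} ->
  exits w U x -> exits w' U' x.
Proof.
move=> ww' UU'; elim=> {x} [x xU|x y xy _ IH].
  by apply: exits_out; apply: contra xU => /UU'.
by apply: exits_step IH; exact: open_edge_le xy.
Qed.

Lemma conn_rcons w U x y z : conn w U x y -> open_edge w y z -> z \in U -> conn w U x z.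
Proof.
move=> c yz zU; elim: c yz => {x y} [x xU|x y t xU xy _ IH] yz.
  by apply: conn_step yz _ => //; exact: conn_refl.
by apply: conn_step xy (IH yz).
Qed.

Lemma conn_exits w U V x y : conn w U x y -> exits w V y -> exits w V x.
Proof.
by move=> c; elim: c => {x y} // x y z _ xy _ IH ez; apply: exits_step xy (IH ez).
Qed.

Lemma conn_last_exit w U C x y : conn w U x y -> x \in C -> y \notin C ->
  exists a b, [/\ a \in C, b \notin C, a \in U, open_edge w a b & conn w (U `\` C)%fset b y].
Proof.
(* This dichotomy passes along the path: either the path from the current vertex avoids [C], or it
   has a last exit from [C]. Starting in [C] excludes the first case. *)
move=> c xC yC; suff [h|//] : conn w (U `\` C)%fset x y \/ exists a b, [/\ a \in C,
   b \notin C, a \in U, open_edge w a b & conn w (U `\` C)%fset b y].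
  by have := conn_l h; rewrite in_fsetD xC.
elim: c yC {xC} => {x y} [x xU|x y z xU xy yz IH] yC.
  by left; apply: conn_refl; rewrite in_fsetD yC.
have [h|h] := IH yC; last by right.
have [xC|xC] := boolP (x \in C).
  right; exists x, y; split => //.
  by have := conn_l h; rewrite in_fsetD => /andP[].
by left; apply: conn_step xy h; rewrite in_fsetD xC.
Qed.

Lemma exits_cluster w U x :
  exits w U x <-> exists2 y, y \notin U & Defs.cluster w x y.
Proof.
split.
  elim=> {x} [x xU|x y xy _ [z zU [s [ps sz]]]].
    by exists x => //; exists [::].
  by exists z => //; exists (y :: s); rewrite /= xy ps.
move=> [y yU [s [+ sy]]]; rewrite -{}sy in yU.
elim: s x yU => [|z s IH] x /= yU; first by move=> _; exact: exits_out.
by move=> /andP[xz ps]; apply: exits_step xz (IH _ _ _).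
Qed.

Definition inside S e := (e.1 \in S) && (tgt e \in S).
Definition touches S e := (e.1 \in S) || (tgt e \in S).

Lemma joins_inside S e u v : joins e u v -> inside S e = (u \in S) && (v \in S).
Proof. by move=> /orP[]/andP[/eqP-> /eqP->]; rewrite // andbC. Qed.

Lemma joins_touches S e u v : joins e u v -> touches S e = (u \in S) || (v \in S).
Proof. by move=> /orP[]/andP[/eqP-> /eqP->]; rewrite // orbC. Qed.

Lemma conn_agree w w' U x y : (forall e, inside U e -> w e = w' e) ->
  conn w U x y -> conn w' U x y.
Proof.
move=> ww'; elim=> {x y} [x xU|x y z xU /open_edgeP[e j we] c IH]; first exact: conn_refl.
apply: conn_step IH => //; apply/open_edgeP; exists e => //.
by rewrite -ww'// (joins_inside _ j) xU (conn_l c).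
Qed.

(** A path can be stopped as soon as it is off [U], and every earlier step uses a bond with an end
    in [U]. *)
Lemma exits_agree w w' U x : (forall e, touches U e -> w e = w' e) ->
  exits w U x -> exits w' U x.
Proof.
move=> ww'; elim=> {x} [x xU|x y /open_edgeP[e j we] _ IH]; first exact: exits_out.
have [xU|xU] := boolP (x \in U); last exact: exits_out.
apply: exits_step IH; apply/open_edgeP; exists e => //.
by rewrite -ww'// (joins_touches _ j) xU.
Qed.

(* [inner] and [outer] are only meaningful for bonds that cross S. *)
Definition crosses S e := (e.1 \in S) (+) (tgt e \in S).
Definition inner S e := if e.1 \in S then e.1 else tgt e.
Definition outer S e := if e.1 \in S then tgt e else e.1.

Lemma crosses_inner S e : crosses S e -> inner S e \in S.
Proof. by rewrite /crosses /inner; case: ifP. Qed.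

Lemma crosses_outer S e : crosses S e -> outer S e \notin S.
Proof. by rewrite /crosses /outer; case: ifP => // ->. Qed.

Lemma joins_inner_outer S e : joins e (inner S e) (outer S e).
Proof. by rewrite /joins /inner /outer; case: ifP; rewrite !eqxx // orbT. Qed.

Lemma crossesP S e u v : joins e u v -> u \in S -> v \notin S ->
  [/\ crosses S e, inner S e = u & outer S e = v].
Proof.
rewrite /crosses /inner /outer => /orP[]/andP[/eqP-> /eqP->] -> h; first by rewrite (negbTE h).
by rewrite (negbTE h).
Qed.

(** A bond touching [S] starts in [S] or one unit vector below a site of [S]; filtering these
    finitely many candidates finds them all. *)
Definition touching S : seq (bond d) :=
  undup [seq e <- [seq (a, i) |
      a <- (enum_fset S ++ [seq v - unitv i | v <- enum_fset S, i <- enum 'I_d]),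
      i <- enum 'I_d] | touches S e].

Lemma mem_touching S e : (e \in touching S) = touches S e.
Proof.
rewrite mem_undup mem_filter; apply: andb_idr => te.
apply/allpairsP; exists e; split; rewrite ?mem_enum//; last by case: (e).
rewrite mem_cat; apply/orP; move: te => /orP[h|h]; [by left|right].
by apply/allpairsP; exists (tgt e, e.2); rewrite mem_enum; split => //; rewrite /= addrK.
Qed.

Lemma uniq_touching S : uniq (touching S). Proof. exact: undup_uniq. Qed.

Lemma crosses_touches S e : crosses S e -> touches S e.
Proof. by rewrite /crosses /touches; case: (e.1 \in S). Qed.

End Connectivity.

(** * Disagreement percolation for the Ising model *)

Section MoreExpect.
Variables (R : realType) (E : eqType).
Implicit Types (q : E -> R) (s : seq E).

Lemma Ex_frozenM q s (c f : (E -> bool) -> R) w : (forall e, e \in s -> insens c e) ->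
  Ex q s (fun v => c v * f v) w = c w * Ex q s f w.
Proof.
move=> ce; rewrite Ex_indep; last by move=> e /ce; left.
congr (_ * _); elim: s ce => [//|e s IH] ce.
rewrite Ex_skip; last exact/ce/mem_head.
by apply: IH => e' e's; apply: ce; rewrite inE e's orbT.
Qed.

Lemma Ex_gt0 q s f w : (forall e, 0 < q e < 1) -> (forall v, 0 < f v) ->
  0 < Ex q s f w.
Proof.
move=> q01 f0; elim: s w => [//|e s IH] w /=.
have /andP[q0 q1] := q01 e.
by rewrite addr_gt0// mulr_gt0// subr_gt0.
Qed.

Lemma convex_le (l x y z : R) : 0 <= l <= 1 -> x <= z -> y <= z ->
  l * x + (1 - l) * y <= z.
Proof.
move=> /andP[l0 l1] xz yz.
have := mulr_ge0 l0 (etrans (subr_ge0 _ _) xz).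
have l1' : 0 <= 1 - l by rewrite subr_ge0.
have := mulr_ge0 l1' (etrans (subr_ge0 _ _) yz).
lra.
Qed.

Lemma convex_dist (D l l' x y x' y' : R) : 0 <= l <= 1 -> 0 <= l' <= 1 ->
  `|x - x'| <= D -> `|x - y'| <= D -> `|y - x'| <= D -> `|y - y'| <= D ->
  `|(l * x + (1 - l) * y) - (l' * x' + (1 - l') * y')| <= D.
Proof.
move=> l01 l'01; rewrite !ler_norml => /andP[? ?] /andP[? ?] /andP[? ?] /andP[? ?].
apply/andP; split.
  suff : l' * x' + (1 - l') * y' <= l * x + (1 - l) * y + D by lra.
  have h z : z <= x + D -> z <= y + D -> z <= l * x + (1 - l) * y + D.
    move=> hx hy; suff : l * (- x) + (1 - l) * (- y) <= D - z by lra.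
    by apply: convex_le => //; lra.
  by apply: convex_le => //; apply: h; lra.
suff : l * x + (1 - l) * y <= l' * x' + (1 - l') * y' + D by lra.
have h z : z <= x' + D -> z <= y' + D -> z <= l' * x' + (1 - l') * y' + D.
  move=> hx hy; suff : l' * (- x') + (1 - l') * (- y') <= D - z by lra.
  by apply: convex_le => //; lra.
by apply: convex_le => //; apply: h; lra.
Qed.

(** The one-bond step of disagreement percolation, used with k = 1 - p: penalizing one of two values
    amounts to keeping the old mean with probability k and otherwise drawing the value afresh with
    weight [l]. *)
Lemma reweight (k A B x y : R) : 0 < A -> 0 < B -> 0 < k <= 1 ->
  exists2 l, 0 <= l <= 1 & (A * x + k * B * y) / (A + k * B) =
    k * ((A * x + B * y) / (A + B)) + (1 - k) * (l * x + (1 - l) * y).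
Proof.
move=> A0 B0 /andP[k0 k1].
have kB0 : 0 < k * B by rewrite mulr_gt0.
have AB0 : 0 < A + B by rewrite addr_gt0.
have AkB0 : 0 < A + k * B by rewrite addr_gt0.
(* Obtained by matching the coefficients of [x]. A factor 1 - k cancels, so k = 1 is covered;
   denominator minus numerator is k B^2. *)
exists ((A * A + A * B + k * A * B) / ((A + k * B) * (A + B))).
  rewrite divr_ge0 ?ler_pdivrMr ?mulr_gt0 ?mul1r//=; last 2 first.
  - by rewrite !addr_ge0 ?mulr_ge0 ?ltW.
  - by rewrite mulr_ge0 ?ltW.
  have := mulr_gt0 kB0 B0; lra.
by field; rewrite !gt_eqF.
Qed.

End MoreExpect.

Section Disagreement.
Variables (R : realType) (d : nat) (p : R) (q : site d -> R).
Hypotheses (p01 : 0 <= p < 1) (q01 : forall v, 0 < q v < 1).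
Implicit Types (F : seq (bond d)) (U D : {fset site d}) (t : site d -> bool).

Definition bond_weight t e : R := if t e.1 == t (tgt e) then 1 else 1 - p.

Definition weight F t : R := \prod_(e <- F) bond_weight t e.

(** Mean of [f] under the Ising law whose interacting bonds are listed in [F] and whose sites
    outside [U] are pinned to [t]. The field enters only through the product measure [q]. *)
Definition spin_avg (f : (site d -> bool) -> R) F U t : R :=
  Ex q (enum_fset U) (fun s => f s * weight F s) t / Ex q (enum_fset U) (weight F) t.

Let q_prob : is_prob q.
Proof. by move=> v; have /andP[/ltW -> /ltW ->] := q01 v. Qed.

Let p_prob : @is_prob R (bond d) (fun=> p).
Proof. by move=> e; have /andP[-> /ltW ->] := p01. Qed.

Lemma bond_weight_gt0 t e : 0 < bond_weight t e.
Proof. by have /andP[_ p1] := p01; rewrite /bond_weight; case: ifP => // _; rewrite subr_gt0. Qed.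

Lemma weight_gt0 F t : 0 < weight F t.
Proof. by apply: prodr_gt0 => e _; exact: bond_weight_gt0. Qed.

Lemma Ex_weight_gt0 s F t : 0 < Ex q s (weight F) t.
Proof. by apply: Ex_gt0 => // v; exact: weight_gt0. Qed.

Lemma spin_avg_ge0_le1 f F U t : (forall s, 0 <= f s <= 1) -> 0 <= spin_avg f F U t <= 1.
Proof.
move=> f01; apply/andP; split.
  apply: divr_ge0; last exact/ltW/Ex_weight_gt0.
  by apply: Ex_ge0 => // v; have /andP[? _] := f01 v; rewrite mulr_ge0// ltW// weight_gt0.
rewrite ler_pdivrMr ?Ex_weight_gt0// mul1r.
by apply: Ex_le => // v; have /andP[_ ?] := f01 v; rewrite ler_piMl// ltW// weight_gt0.
Qed.

Lemma Ex_rem U u g t : u \in U -> Ex q (enum_fset U) g t =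
  q u * Ex q (enum_fset (U `\ u)%fset) g (upd t u true)
  + (1 - q u) * Ex q (enum_fset (U `\ u)%fset) g (upd t u false).
Proof.
move=> uU; rewrite (@Ex_perm _ _ q _ (u :: enum_fset (U `\ u)%fset))//.
apply: uniq_perm; rewrite /= ?fset_uniq ?andbT// ?in_fsetD1 ?eqxx//.
by move=> v; rewrite inE in_fsetD1; case: eqVneq => [->|].
Qed.

Lemma bond_weight_joins t e u v : joins e u v ->
  bond_weight t e = if t u == t v then 1 else 1 - p.
Proof. by move=> /orP[]/andP[/eqP-> /eqP->]; rewrite // eq_sym. Qed.

Lemma spin_avg_rem f F U u t : u \in U ->
  spin_avg f F U t =
  let A := q u * Ex q (enum_fset (U `\ u)%fset) (weight F) (upd t u true) in
  let B := (1 - q u) * Ex q (enum_fset (U `\ u)%fset) (weight F) (upd t u false) in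
  (A * spin_avg f F (U `\ u)%fset (upd t u true) +
   B * spin_avg f F (U `\ u)%fset (upd t u false)) / (A + B).
Proof.
move=> uU; rewrite /spin_avg !(Ex_rem _ _ uU) /=.
by congr ((_ + _) / _); rewrite -mulrA; congr (_ * _); rewrite mulrCA mulfV ?mulr1//
  gt_eqF// Ex_weight_gt0.
Qed.

(** A bond with both ends pinned contributes the same constant to numerator and denominator. *)
Lemma spin_avg_frozen f F U e t : ~~ touches U e ->
  spin_avg f (e :: F) U t = spin_avg f F U t.
Proof.
move=> te; rewrite /spin_avg.
have fr v : v \in enum_fset U -> insens (bond_weight^~ e) v.
  move=> vU s b; rewrite /bond_weight /upd.
  move: te; rewrite /touches negb_or => /andP[h1 h2].
  have -> : (e.1 == v) = false by apply: contraNF h1 => /eqP ->.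
  by have -> : (tgt e == v) = false by apply: contraNF h2 => /eqP ->.
rewrite (@Ex_ext _ _ _ _ (weight (e :: F)) (fun s => bond_weight s e * weight F s)); last first.
  by move=> s; rewrite /weight big_cons.
rewrite (@Ex_ext _ _ _ _ (fun s => f s * weight (e :: F) s)
  (fun s => bond_weight s e * (f s * weight F s))); last first.
  by move=> s; rewrite /weight big_cons mulrCA.
by rewrite !(Ex_frozenM _ _ _ fr) invfM mulrACA mulfV ?mul1r// gt_eqF// bond_weight_gt0.
Qed.

(** Condition on the spin at [u]: the new bond multiplies the mass of the value that disagrees with
    [t v] by 1 - p, so [reweight] applies. *)
Lemma spin_avg_crosses f F U u v e t : joins e u v -> u \in U -> v \notin U ->
  exists2 l, 0 <= l <= 1 & spin_avg f (e :: F) U t =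
    (1 - p) * spin_avg f F U t +
    p * (l * spin_avg f F (U `\ u)%fset (upd t u true) +
         (1 - l) * spin_avg f F (U `\ u)%fset (upd t u false)).
Proof.
move=> jn uU vU; have /andP[p0 p1] := p01.
have [qu0 qu1] := andP (q01 u).
rewrite !(spin_avg_rem _ _ _ uU) /=.
have uv : u != v by apply: contraNneq vU => <-.
have te : ~~ touches (U `\ u)%fset e.
  by rewrite (joins_touches _ jn) !in_fsetD1 eqxx /= negb_and negbK vU orbT.
rewrite !(spin_avg_frozen _ _ _ te).
set m1 := spin_avg _ _ _ (upd t u true); set m0 := spin_avg _ _ _ (upd t u false).
have E b : Ex q (enum_fset (U `\ u)%fset) (weight (e :: F)) (upd t u b) =
  (if b == t v then 1 else 1 - p) * Ex q (enum_fset (U `\ u)%fset) (weight F) (upd t u b).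
  rewrite (@Ex_ext _ _ _ _ (weight (e :: F)) (fun s => bond_weight s e * weight F s)); last first.
    by move=> s; rewrite /weight big_cons.
  rewrite Ex_frozenM => [|z zU s c].
    by rewrite (bond_weight_joins _ jn) /upd eqxx [v == u]eq_sym (negbTE uv).
  rewrite !(bond_weight_joins _ jn) /upd.
  have zu : z != u by move: zU; rewrite in_fsetD1 => /andP[].
  have zv : z != v by apply: contraNneq vU => <-; move: zU; rewrite in_fsetD1 => /andP[].
  by rewrite ![_ == z]eq_sym (negbTE zu) (negbTE zv).
rewrite !E.
set a1 := Ex _ _ _ _; set a0 := Ex _ _ _ _.
have A0 : 0 < q u * a1 by rewrite mulr_gt0// Ex_weight_gt0.
have B0 : 0 < (1 - q u) * a0 by rewrite mulr_gt0 ?subr_gt0// Ex_weight_gt0.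
have k01 : 0 < 1 - p <= 1 by rewrite subr_gt0 p1 gerBl.
(* The penalized value is the one opposite to [t v]; when [t v] is false the two values swap roles
   and [l] becomes [1 - l]. *)
case: (t v) => /=; rewrite mul1r.
  have [l l01 hl] := reweight m1 m0 A0 B0 k01.
  exists l => //; rewrite subKr in hl.
  by rewrite [(1 - q u) * (_ * _)]mulrCA hl.
have [l /andP[l0 l1] hl] := reweight m0 m1 B0 A0 k01.
exists (1 - l); first by rewrite subr_ge0 l1 gerBl l0.
rewrite subKr in hl; rewrite subKr [q u * (_ * _)]mulrCA.
rewrite [X in X / _ = _]addrC [X in _ / X = _]addrC hl.
congr (_ * _ + _ * _); last exact: addrC.
by congr (_ / _); exact: addrC.
Qed.

Definition exits_event U D : config d -> R :=
  fun w => ind (exists2 z, z \in D & exits w U z).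

Lemma exits_event_incr U D : incr (exits_event U D).
Proof.
move=> w w' ww'; apply: ind_le => -[z zD zU]; exists z => //.
exact: exits_le zU.
Qed.

Lemma Ex_exits_frozen F U D e : Ex (fun=> p) F (exits_event U D) xpred0 <=
  Ex (fun=> p) (e :: F) (exits_event U D) xpred0.
Proof.
have u0 : upd (xpred0 : config d) e false = xpred0 by exact: upd_id.
rewrite /= u0.
have h : Ex (fun=> p) F (exits_event U D) xpred0 <=
    Ex (fun=> p) F (exits_event U D) (upd xpred0 e true).
  by apply: Ex_incr => //; exact: exits_event_incr.
have /andP[p0 _] := p01.
by have := mulr_ge0 p0 (etrans (subr_ge0 _ _) h); lra.
Qed.

(** If [e] is open, an exit from [U] without [u] yields an exit from [U], since a path that reaches
    [u] can leave through [e] to [v]. If [e] is closed, nothing changes. *)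
Lemma Ex_exits_crosses F U D u v e : e \notin F -> joins e u v -> v \notin U ->
  (1 - p) * Ex (fun=> p) F (exits_event U D) xpred0
   + p * Ex (fun=> p) F (exits_event (U `\ u)%fset D) xpred0 <=
  Ex (fun=> p) (e :: F) (exits_event U D) xpred0.
Proof.
move=> eF jn vU /=.
have u0 : upd (xpred0 : config d) e false = xpred0 by exact: upd_id.
rewrite u0 addrC lerD2r; have /andP[p0 _] := p01.
apply: ler_wpM2l => //; rewrite (Ex_upd _ _ _ _ eF).
apply: Ex_le => // w; apply: ind_le => -[z zD zU]; exists z => //.
have ww' : forall e', w e' ==> upd w e true e'.
  by move=> e'; rewrite /upd; case: ifP; rewrite ?implybT ?implybb.
elim: zU {zD} => {z} [z|z y zy _ IH]; last exact: exits_step (open_edge_le ww' zy) IH.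
rewrite in_fsetD1 negb_and negbK => /orP[/eqP->|zU]; last exact: exits_out.
apply: (@exits_step _ _ _ _ v); last exact: exits_out.
by apply/open_edgeP; exists e; rewrite // /upd eqxx.
Qed.

Lemma spin_avg_perm f F F' U t : perm_eq F F' -> spin_avg f F U t = spin_avg f F' U t.
Proof.
move=> FF'; have h s : weight F s = weight F' s by exact: perm_big.
by rewrite /spin_avg; congr (_ / _); apply: Ex_ext => s; rewrite h.
Qed.

Lemma weight_dep F U s s' : (forall e, e \in F -> inside U e) -> {in U, s =1 s'} ->
  weight F s = weight F s'.
Proof.
move=> FU ss'; rewrite /weight !big_seq; apply: eq_bigr => e /FU/andP[h1 h2].
by rewrite /bond_weight !ss'.
Qed.

(* Reveal a bond joining the pinned region to an unpinned site u: with
   probability 1 - p it is dropped, otherwise u becomes pinned too (to a random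
   value that may differ between the two systems). *)
Lemma spin_avg_dist f D F U t t' : uniq F -> (forall s, 0 <= f s <= 1) ->
  (forall s s', {in D, s =1 s'} -> f s = f s') ->
  `|spin_avg f F U t - spin_avg f F U t'| <= Ex (fun=> p) F (exits_event U D) xpred0.
Proof.
move=> + f01 fD; have [n] := ubnP (size F).
elim: n => // n IH in F U t t' *; rewrite ltnS => Fn uF.
(* If some site of [D] is pinned, the exit event is certain and the bound is 1. *)
have [DU|/fsubsetPn[z zD zU]] := boolP (D `<=` U)%fset; last first.
  rewrite (@Ex_ext _ _ _ _ _ (fun=> 1)) ?Ex_cst => [|w].
    have /andP[? ?] := spin_avg_ge0_le1 F U t f01.
    have /andP[? ?] := spin_avg_ge0_le1 F U t' f01.
    by rewrite ler_norml; apply/andP; split; lra.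
  by apply: indT; exists z => //; exact: exits_out.
(* When every remaining bond joins unpinned sites, neither average sees the pinned values, so they
   coincide. *)
have [/allP allU|/allPn[e eF eU]] := boolP (all (inside U) F).
  rewrite [X in `|X|](_ : _ = 0) ?normr0.
    by apply: Ex_ge0 => // w; exact: ind_ge0.
  apply/eqP; rewrite subr_eq0; apply/eqP; rewrite /spin_avg; congr (_ / _).
    apply: Ex_dep => v v' vv' _ _; rewrite (weight_dep allU vv'); congr (_ * _).
    by apply: fD => z /(fsubsetP DU) zU; exact: vv'.
  by apply: Ex_dep => v v' vv' _ _; rewrite (weight_dep allU vv').
have Fe := perm_to_rem eF; move: uF Fn; rewrite (perm_uniq Fe) (perm_size Fe).
rewrite !(spin_avg_perm _ _ _ Fe) (Ex_perm _ _ _ Fe); move: (rem e F) => {Fe eF}F.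
move=> /= /andP[eF uF] Fn.
have [te|te] := boolP (touches U e); last first.
  rewrite !spin_avg_frozen//; apply: le_trans (Ex_exits_frozen _ _ _ _).
  exact: IH.
have ce : crosses U e.
  by move: eU te; rewrite /inside /touches /crosses; case: (e.1 \in U); case: (tgt e \in U).
have uU := crosses_inner ce; have vU := crosses_outer ce; have jn := joins_inner_outer U e.
apply: le_trans (Ex_exits_crosses D eF jn vU).
have [l l01 ->] := spin_avg_crosses f F t jn uU vU.
have [l' l'01 ->] := spin_avg_crosses f F t' jn uU vU.
rewrite opprD addrACA -!mulrBr; apply: le_trans (ler_normD _ _) _.
have /andP[p0 p1] := p01; have p1' : 0 <= 1 - p by rewrite subr_ge0 ltW.
rewrite !normrM (ger0_norm p0) (ger0_norm p1').
apply: lerD; apply: ler_wpM2l => //; first exact: IH.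
(* The two systems mix with different weights, so the induction hypothesis is applied to all four
   pairs of values at the newly pinned site. *)
by apply: convex_dist => //; exact: IH.
Qed.

End Disagreement.

(** * Exponential decay from the Simon-Lieb inequality *)

Section Sums.
Variables (R : realType) (I : eqType).
Implicit Types (r : seq I) (F : I -> R).

Lemma ler_term_sum r (P : pred I) F i : i \in r -> P i -> (forall j, P j -> 0 <= F j) ->
  F i <= \sum_(j <- r | P j) F j.
Proof.
move=> ir Pi F0; rewrite (big_rem i)//= Pi lerDl.
by apply: sumr_ge0 => j; exact: F0.
Qed.

Lemma sum_ind_eq r F i : uniq r -> i \in r ->
  \sum_(j <- r) ind (i = j) * F j = F i.
Proof.
move=> ur ir; rewrite (bigD1_seq i)//= indT// mul1r big1 ?addr0// => j ji.
by rewrite indF ?mul0r// => ij; rewrite ij eqxx in ji.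
Qed.

End Sums.

Section Insensitivity.
Variables (R : realType) (E : eqType).

(** One implication suffices, since a second update restores the original value. *)
Lemma insens_ind (P : (E -> bool) -> Prop) e :
  (forall w b, P w -> P (upd w e b)) -> insens (fun w => ind (P w) : R) e.
Proof.
move=> h w b; apply: ind_iff; split; last exact: h.
by move/h => /(_ (w e)); rewrite upd_same upd_id.
Qed.

Lemma insensM (f g : (E -> bool) -> R) e : insens f e -> insens g e ->
  insens (fun w => f w * g w) e.
Proof. by move=> fe ge w b; rewrite fe ge. Qed.

(** Only an inequality, because a coordinate outside [s] is frozen to false. *)
Lemma Ex_coord (p : R) (s : seq E) e : uniq s -> 0 <= p <= 1 ->
  Ex (fun=> p) s (fun w => (w e)%:R) xpred0 <= p.
Proof.
move=> us p01; have ip : @is_prob R E (fun=> p) by [].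
apply: le_trans (@Ex_incl R E _ s [:: e] _ ip _ us _ _) _ => //=.
- by move=> w w' ww'; rewrite ler_nat; have := ww' e; case: (w e); case: (w' e).
- by move=> e'; rewrite inE => ne w b; rewrite /upd eq_sym (negbTE ne).
- by rewrite /upd eqxx /= mulr1 mulr0 addr0.
Qed.

Lemma Ex_all_false (p : R) (s l : seq E) : uniq s -> uniq l -> 0 <= p <= 1 ->
  (1 - p) ^+ size l <= Ex (fun=> p) s (fun w => \prod_(e <- l) (1 - (w e)%:R)) xpred0.
Proof.
move=> us ul p01; elim: l ul => [_|e l IH /= /andP[el ul]].
  by rewrite (@Ex_ext _ _ _ _ _ (fun=> 1)) ?Ex_cst// => w; rewrite big_nil.
rewrite (@Ex_ext _ _ _ _ _ (fun w => (1 - (w e)%:R) * \prod_(e <- l) (1 - (w e)%:R)));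
  last by move=> w; rewrite big_cons.
rewrite Ex_indep => [|e' _].
  rewrite exprS; apply: ler_pM; rewrite ?exprn_ge0 ?subr_ge0 ?IH//; try by case/andP: p01.
  by rewrite ExB Ex_cst lerB// Ex_coord.
have [->|ne] := eqVneq e' e; [right|left] => w b; last by rewrite /upd eq_sym (negbTE ne).
rewrite !big_seq; apply: eq_bigr => e'' e''l; rewrite /upd.
by case: eqP => // e''e; rewrite -e''e e''l in el.
Qed.

End Insensitivity.

(** * Clusters in finite sets and the Simon-Lieb inequality *)

Section SimonLieb.
Variables (R : realType) (d : nat).
Implicit Types (w : config d) (e : bond d) (x y u v : site d) (U S T C : {fset site d}).

Lemma conn_incr U x y : incr (fun w => ind (conn w U x y) : R).
Proof. by move=> w w' ww'; apply: ind_le; exact: conn_le. Qed.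

Lemma conn_insens U x y e : ~~ inside U e -> insens (fun w => ind (conn w U x y) : R) e.
Proof.
move=> Ue; apply: insens_ind => w b; apply: conn_agree => e' Ue'.
by rewrite /upd; case: eqP => // e'e; rewrite e'e (negbTE Ue) in Ue'.
Qed.

(** Kept as a finite set so that events can be partitioned by its value, which ranges over a power
    set. *)
Definition clus w U x : {fset site d} := [fset z in U | `[< conn w U x z >]]%fset.

Lemma in_clus w U x z : reflect (conn w U x z) (z \in clus w U x).
Proof.
apply: (iffP idP); rewrite !inE /=; first by move=> /andP[_ /asboolP].
by move=> c; rewrite (conn_r c); apply/asboolP.
Qed.

Lemma clus_sub w U x : (clus w U x `<=` U)%fset.
Proof. by apply/fsubsetP => z /in_clus/conn_r. Qed.

(** Exploring the cluster inspects only bonds inside [U] that touch it. *)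
Lemma clus_agree w w' U x :
  (forall e, inside U e -> touches (clus w U x) e -> w e = w' e) ->
  clus w' U x = clus w U x.
Proof.
move=> ww'.
have agree a b : a \in clus w U x -> b \in U -> open_edge w a b = open_edge w' a b.
  move=> aC bU; have aU := fsubsetP (clus_sub w U x) _ aC.
  by apply/open_edgeP/open_edgeP => -[e j we]; exists e => //;
    [rewrite -ww'//|rewrite ww'//];
    rewrite ?(joins_inside _ j) ?(joins_touches _ j) ?aU ?bU ?aC.
have H1 z a : conn w' U a z -> a \in clus w U x -> z \in clus w U x.
  elim=> {a z} // a b z aU ab bz IH aC; apply: IH.
  have bU := conn_l bz; apply/in_clus; move: ab; rewrite -agree//.
  by move/in_clus : aC => aC ab; exact: conn_rcons ab bU.
have H2 z a : conn w U a z -> a \in clus w U x -> conn w' U a z.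
  elim=> {a z} [a aU _|a b z aU ab bz IH aC]; first exact: conn_refl.
  have bU := conn_l bz; apply: (@conn_step _ _ _ _ b) => //; first by rewrite -agree.
  by apply: IH; apply/in_clus; move/in_clus : aC => aC; exact: conn_rcons ab bU.
have xC z : conn w U x z \/ conn w' U x z -> x \in clus w U x.
  by move=> c; apply/in_clus; apply: conn_refl; case: c => /conn_l.
apply/fsetP => z; apply/in_clus/idP => [c|/in_clus c].
  by apply: H1 (c) _; apply: xC; right; exact: c.
by apply: H2 (c) _; apply: xC; left; exact: c.
Qed.

Lemma clus_insens U x C e : ~~ (inside U e && touches C e) ->
  insens (fun w => ind (clus w U x = C) : R) e.
Proof.
move=> UC; apply: insens_ind => w b wC; rewrite -[in RHS]wC.
apply: clus_agree => e' Ue' Ce'; rewrite /upd; case: eqP => // e'e.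
by move: UC; rewrite -e'e Ue' -wC Ce'.
Qed.

Section Inequality.
Variables (p : R) (p01 : 0 <= p <= 1) (s : seq (bond d)) (us : uniq s).

Let pp : @is_prob R (bond d) (fun=> p). Proof. by []. Qed.

(* Decompose according to the cluster of x in T and to the bond through which
   the path to y leaves it for the last time. *)
Lemma simon_lieb U T x y (B : site d -> R) : x \in T -> y \notin T ->
  (forall v, 0 <= B v) ->
  (forall U' v, (U' `<` U)%fset -> Ex (fun=> p) s (fun w => ind (conn w U' v y)) xpred0 <= B v) ->
  Ex (fun=> p) s (fun w => ind (conn w U x y)) xpred0 <=
  \sum_(e <- touching T | crosses T e)
    p * Ex (fun=> p) s (fun w => ind (conn w T x (inner T e))) xpred0 * B (outer T e).
Proof.
move=> xT yT B0 UB.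
have [xU|xU] := boolP (x \in U); last first.
  rewrite (@Ex_ext _ _ _ _ _ (fun=> 0)) ?Ex_cst => [|w].
    apply: sumr_ge0 => e _; rewrite !mulr_ge0//; first by case/andP: p01.
    by apply: Ex_ge0 => // w; exact: ind_ge0.
  by apply: indF => /conn_l; rewrite (negbTE xU).
set V := (U `&` T)%fset; have xV : x \in V by rewrite in_fsetI xU.
(* The cluster of [x] in [V] is [C], the open bond [e] leaves it, and the path continues to [y] off
   [C]. *)
pose g C e w : R := ind (clus w V x = C) * ind (inner T e \in C) *
  ((w e)%:R * ind (conn w (U `\` C)%fset (outer T e) y)).
apply: (@le_trans _ _ (Ex (fun=> p) s (fun w =>
   \sum_(e <- touching T | crosses T e) \sum_(C <- fpowerset V) g C e w) xpred0)).
  apply: Ex_le => // w.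
  have g0 C e : 0 <= g C e w by rewrite !mulr_ge0 ?ind_ge0 ?ler0n.
  have [c|nc] := pselect (conn w U x y); last first.
    by rewrite indF// sumr_ge0// => e _; rewrite sumr_ge0.
  have xC : x \in clus w V x by apply/in_clus; exact: conn_refl.
  have yC : y \notin clus w V x.
    by apply: contra yT => /(fsubsetP (clus_sub _ _ _)); rewrite in_fsetI => /andP[].
  have [a [b [aC bC aU ab cb]]] := conn_last_exit c xC yC.
  have aT : a \in T by have := fsubsetP (clus_sub _ _ _) _ aC; rewrite in_fsetI => /andP[].
  (* Had [b] been in [T], the open bond from [a] would have put it in the cluster. *)
  have bT : b \notin T.
    apply: contra bC => bT; have := conn_l cb; rewrite in_fsetD => /andP[_ bU].
    apply/in_clus; apply: conn_rcons ab _; last by rewrite in_fsetI bU.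
    exact/in_clus.
  have [e j we] := open_edgeP _ _ _ ab.
  have [ce ine oute] := crossesP j aT bT.
  rewrite indT//; apply: (@le_trans _ _ (g (clus w V x) e w)).
    by rewrite /g ine oute !indT// we !mulr1.
  apply: (@le_trans _ _ (\sum_(C <- fpowerset V) g C e w)).
    apply: (@ler_term_sum _ _ (fpowerset V) predT (fun C => g C e w)) => //.
    by rewrite fpowersetE clus_sub.
  apply: (@ler_term_sum _ _ (touching T) (crosses T)
    (fun e => \sum_(C <- fpowerset V) g C e w)) => //.
    by rewrite mem_touching crosses_touches.
  by move=> e' _; rewrite sumr_ge0.
rewrite Ex_sum; apply: ler_sum => e ce; rewrite Ex_sum.
have gE C : Ex (fun=> p) s (g C e) xpred0 <= p * B (outer T e) *
    Ex (fun=> p) s (fun w => ind (clus w V x = C) * ind (inner T e \in C)) xpred0.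
  have [xC|xC] := boolP (x \in C); last first.
    rewrite (@Ex_ext _ _ _ _ (g C e) (fun=> 0)) => [|w]; last first.
      rewrite /g [X in X * _ * _]indF ?mul0r// => wC; move: xC.
      by rewrite -wC (introT (in_clus _ _ _ _))//; exact: conn_refl.
    rewrite Ex_cst mulr_ge0// ?mulr_ge0//; first by case/andP: p01.
    by apply: Ex_ge0 => // w; rewrite mulr_ge0 ?ind_ge0.
  have [eC|/negP eC] := pselect (is_true (inner T e \in C)); last first.
    rewrite (@Ex_ext _ _ _ _ (g C e) (fun=> 0)) => [|w]; last first.
      by rewrite /g [X in _ * X * _]indF ?mulr0 ?mul0r//; exact/negP.
    rewrite Ex_cst mulr_ge0// ?mulr_ge0//; first by case/andP: p01.
    by apply: Ex_ge0 => // w; rewrite mulr_ge0 ?ind_ge0.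
  (* The cluster event sees only bonds inside [V] that touch [C], whereas [e] crosses [T] and the
     continuation stays off [C]. *)
  rewrite /g Ex_indep => [|e' _]; last first.
    have [/andP[VE CE]|h] := boolP (inside V e' && touches C e'); last first.
      by left => w b; rewrite (clus_insens _ h).
    right; apply: insensM.
      move=> w b; rewrite /upd; case: eqP => // ee'; move: VE ce; rewrite -ee'.
      rewrite /inside /crosses !in_fsetI => /andP[/andP[_ ->] /andP[_ ->]] //.
    apply: conn_insens; apply: contraL CE.
    by rewrite /inside /touches !in_fsetD negb_or => /andP[/andP[-> _] /andP[-> _]].
  rewrite [leLHS]mulrC; apply: ler_wpM2r.
    by apply: Ex_ge0 => // w; rewrite mulr_ge0 ?ind_ge0.
  rewrite Ex_indep => [|e' _]; last first.
    have [->|ne] := eqVneq e' e.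
      right; apply: conn_insens.
      by rewrite (joins_inside _ (joins_inner_outer T e)) in_fsetD eC.
    by left => w b; rewrite /upd eq_sym (negbTE ne).
  apply: ler_pM; rewrite ?Ex_coord//.
  - by apply: Ex_ge0 => // w; exact: ler0n.
  - by apply: Ex_ge0 => // w; exact: ind_ge0.
  (* Removing [C] removes [x] from [U]; the strict inclusion later feeds an induction on the size of
     [U]. *)
  apply: UB; rewrite fproperE fsubsetDl /=; apply/negP => /fsubsetP/(_ x xU).
  by rewrite in_fsetD xC.
apply: (@le_trans _ _ (\sum_(C <- fpowerset V) (p * B (outer T e) *
    Ex (fun=> p) s (fun w => ind (clus w V x = C) * ind (inner T e \in C)) xpred0))).
  exact: (ler_sum _ (fun C _ => gE C)).
rewrite -mulr_sumr -Ex_sum [leRHS]mulrAC; apply: ler_wpM2l.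
  by rewrite mulr_ge0//; case/andP: p01.
apply: Ex_le => // w.
rewrite (@sum_ind_eq _ _ (fpowerset V) (fun C => ind (inner T e \in C)))//; last first.
  by rewrite fpowersetE clus_sub.
apply: ind_le => /in_clus; apply: conn_le => [e'|z]; first exact: implybb.
by rewrite in_fsetI => /andP[].
Qed.

End Inequality.
End SimonLieb.

(** * Translation invariance of connection probabilities *)

Section Translation.
Variables (R : realType) (d : nat).
Implicit Types (w : config d) (e : bond d) (x y u v : site d) (S : {fset site d}).

Definition shift x e : bond d := (x + e.1, e.2).
Definition shiftS x S : {fset site d} := [fset (x + z)%R | z in S]%fset.

Lemma shiftK x : cancel (shift x) (shift (- x)).
Proof. by case=> a i; rewrite /shift /= addKr. Qed.

Lemma shiftNK x : cancel (shift (- x)) (shift x).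
Proof. by case=> a i; rewrite /shift /= addNKr. Qed.

Lemma mem_shiftS x S z : (z \in shiftS x S) = (- x + z \in S).
Proof.
apply/imfsetP/idP => [[u uS ->]|zS]; first by rewrite addKr.
by exists (- x + z); rewrite ?addNKr.
Qed.

Lemma tgt_shift x e : tgt (shift x e) = x + tgt e.
Proof. by rewrite /tgt /= addrA. Qed.

Lemma joins_shift x e u v : joins e u v -> joins (shift x e) (x + u) (x + v).
Proof.
by move=> /orP[]/andP[/eqP-> /eqP->]; rewrite /joins tgt_shift !eqxx // orbT.
Qed.

Lemma conn_shift x w S u v : conn w (shiftS x S) u v ->
  conn (w \o shift x) S (- x + u) (- x + v).
Proof.
elim=> {u v} [u|u v z uS /open_edgeP[e j we] _ IH]; rewrite ?mem_shiftS.
  exact: conn_refl.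
apply: conn_step IH; first by rewrite -mem_shiftS.
apply/open_edgeP; exists (shift (- x) e); first exact: joins_shift.
by rewrite /= shiftNK.
Qed.

Lemma crosses_shift x S e : crosses (shiftS x S) (shift x e) = crosses S e.
Proof. by rewrite /crosses !mem_shiftS tgt_shift /= !addKr. Qed.

Lemma inner_shift x S e : inner (shiftS x S) (shift x e) = x + inner S e.
Proof. by rewrite /inner !mem_shiftS tgt_shift /= addKr; case: ifP. Qed.

Lemma outer_shift x S e : outer (shiftS x S) (shift x e) = x + outer S e.
Proof. by rewrite /outer !mem_shiftS tgt_shift /= addKr; case: ifP. Qed.

Lemma touches_shift x S e : touches (shiftS x S) (shift x e) = touches S e.
Proof. by rewrite /touches !mem_shiftS tgt_shift /= !addKr. Qed.

Lemma touching_shift x S : perm_eq (touching (shiftS x S)) (map (shift x) (touching S)).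
Proof.
apply: uniq_perm; rewrite ?uniq_touching//.
  by rewrite (map_inj_uniq (can_inj (shiftK x))) uniq_touching.
move=> e; rewrite mem_touching; apply/idP/mapP => [te|[e' te' ->]].
  exists (shift (- x) e); rewrite ?shiftNK// mem_touching.
  by rewrite -(touches_shift x) shiftNK.
by rewrite touches_shift -mem_touching.
Qed.

Lemma inside_touches S e : inside S e -> touches S e.
Proof. by rewrite /inside /touches => /andP[->]. Qed.

Lemma Ex_conn_shift (p : R) s x S v : 0 <= p <= 1 -> uniq s ->
  Ex (fun=> p) s (fun w => ind (conn w (shiftS x S) x (x + v))) xpred0 <=
  Ex (fun=> p) (touching S) (fun w => ind (conn w S 0 v)) xpred0.
Proof.
move=> p01 us; have pp : @is_prob R (bond d) (fun=> p) by [].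
apply: le_trans (@Ex_incl _ _ _ s (map (shift x) (touching S)) _ pp _ us _ _) _.
- exact: conn_incr.
- by rewrite -(perm_uniq (touching_shift x S)) uniq_touching.
- move=> e; rewrite -(perm_mem (touching_shift x S)) mem_touching => te.
  by apply: conn_insens; apply: contra te; exact: inside_touches.
rewrite -[xpred0 in leLHS]/(xpred0 \o shift (- x)) (Ex_map _ _ _ _ (shiftK x) (shiftNK x)).
apply: Ex_le => // w; apply: ind_le => /conn_shift.
rewrite addNr addKr; apply: conn_le => // e /=.
by rewrite shiftK implybb.
Qed.

End Translation.

(** * Iteration of the Simon-Lieb inequality *)

Section Decay.
Variables (R : realType) (d : nat).
Implicit Types (w : config d) (e : bond d) (x y u v : site d) (U S T C : {fset site d}).

Definition l1 x : R := \sum_(i < d) `|(x 0 i)%:~R|.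

Lemma l1_ge0 x : 0 <= l1 x. Proof. by apply: sumr_ge0. Qed.

Lemma l1_0 : l1 0 = 0. Proof. by rewrite /l1 big1// => i _; rewrite mxE normr0. Qed.

Lemma l1D x y : l1 (x + y) <= l1 x + l1 y.
Proof.
rewrite /l1 -big_split /=; apply: ler_sum => i _.
by rewrite mxE intrD; exact: ler_normD.
Qed.

Lemma l1N x : l1 (- x) = l1 x.
Proof. by rewrite /l1; apply: eq_bigr => i _; rewrite mxE intrN normrN. Qed.

(** Squaring the sum of absolute values adds nonnegative cross terms to the sum of squares. *)
Lemma eucl_le_l1 x y : eucl_dist R x y <= l1 (x - y).
Proof.
rewrite /eucl_dist /l1.
have h (r : seq 'I_d) : \sum_(i <- r) ((x 0 i - y 0 i)%:~R ^+ 2 : R) <=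
    (\sum_(i <- r) `|((x - y) 0 i)%:~R|) ^+ 2.
  elim: r => [|i r IH]; first by rewrite !big_nil expr0n.
  rewrite !big_cons sqrrD !mxE -addrA real_normK ?num_real// lerD2l.
  apply: le_trans IH _; rewrite lerDr mulrn_wge0// mulr_ge0//.
  by apply: sumr_ge0.
have n0 : 0 <= \sum_(i < d) (`|((x - y) 0 i)%:~R| : R) by apply: sumr_ge0.
by rewrite -[leRHS](ger0_norm n0) -sqrtr_sqr; apply: ler_wsqrtr; exact: h.
Qed.

(* the quantity phi_p(S) of Duminil-Copin and Tassion, without its factor p *)
Definition phi (p : R) S : R :=
  \sum_(e <- touching S | crosses S e)
    Ex (fun=> p) (touching S) (fun w => ind (conn w S 0 (inner S e))) xpred0.

Lemma conn_open w U x y : conn w U x y -> x != y -> exists2 e, exists t, joins e x t & w e.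
Proof.
case=> {x y} [x _|x t y _ /open_edgeP[e j we] _ _]; first by rewrite eqxx.
by exists e => //; exists t.
Qed.

(** Leaving [x] requires one of its at most 2d bonds to be open. For p < 1 this bound is below 1
    uniformly in both sites, which settles the case of nearby sites in the decay estimate. *)
Lemma Ex_conn_neq (p : R) s U x y : 0 <= p <= 1 -> uniq s -> x != y ->
  Ex (fun=> p) s (fun w => ind (conn w U x y)) xpred0 <= 1 - (1 - p) ^+ (d + d).
Proof.
move=> /[dup] p01 /andP[p0 p1] us xy.
pose l : seq (bond d) :=
  undup ([seq (x, i) | i <- enum 'I_d] ++ [seq (x - unitv i, i) | i <- enum 'I_d]).
have sl : (size l <= d + d)%N.
  by apply: leq_trans (size_undup _) _; rewrite size_cat !size_map -!enumT size_enum_ord.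
apply: (@le_trans _ _ (1 - (1 - p) ^+ size l)); last first.
  by rewrite lerB// ler_wiXn2l// ?subr_ge0// gerBl.
apply: (@le_trans _ _ (Ex (fun=> p) s (fun w => 1 - \prod_(e <- l) (1 - (w e)%:R)) xpred0));
  last by rewrite ExB Ex_cst lerB// Ex_all_false// undup_uniq.
apply: Ex_le => // w.
have Pr r : \prod_(e <- r) (1 - (w e)%:R) <= 1 :> R.
  by apply: prodr_ile1 => e _; case: (w e); rewrite ?subrr ?subr0 ?lexx ?ler01.
have [c|nc] := pselect (conn w U x y); last by rewrite indF// subr_ge0.
have [e [t j] we] := conn_open c xy.
have el : e \in l.
  case: e j {we} => a i; rewrite /joins /tgt /= mem_undup mem_cat.
  move=> /orP[]/andP[/eqP E1 /eqP E2]; apply/orP; [left|right]; apply/mapP; exists i;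
    by rewrite ?mem_enum ?E1 ?E2 ?addrK.
by rewrite (big_rem e)//= we subrr mul0r subr0 ind_le1.
Qed.

(** Induction on the size of [U]: Simon-Lieb for the translate of [S] to [x] gains the factor
    [p * phi p S], while the starting point moves by a bounded distance. *)
Lemma conn_exp_decay (p : R) S : 0 <= p < 1 -> 0 \in S -> p * phi p S < 1 ->
  exists2 c, 0 < c & forall U s x y, uniq s ->
    Ex (fun=> p) s (fun w => ind (conn w U x y)) xpred0 <= expR (- c * l1 (x - y)).
Proof.
move=> /andP[p0 p1] S0 pS.
have p01 : 0 <= p <= 1 by rewrite p0 ltW.
have pp : @is_prob R (bond d) (fun=> p) by [].
have [N N0 [NS NO]] : exists2 N : R, 0 < N & (forall z, z \in S -> l1 z <= N) /\
    (forall e, e \in touching S -> l1 (outer S e) <= N).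
  pose A := \sum_(z <- S) l1 z; pose B := \sum_(e <- touching S) l1 (outer S e).
  have A0 : 0 <= A by apply: sumr_ge0 => z _; exact: l1_ge0.
  have B0 : 0 <= B by apply: sumr_ge0 => z _; exact: l1_ge0.
  exists (A + B + 1); first by rewrite ltr_wpDl// addr_ge0.
  split=> [z zS|e te].
    have : l1 z <= A by apply: (@ler_term_sum _ _ _ predT l1) => // u _; exact: l1_ge0.
    lra.
  have : l1 (outer S e) <= B.
    by apply: (@ler_term_sum _ _ _ predT (fun e => l1 (outer S e))) => // u _; exact: l1_ge0.
  lra.
pose th : R := 1 - (1 - p) ^+ (d + d).
have th1 : th < 1 by rewrite ltrBlDr ltrDl exprn_gt0// subr_gt0.
(* [m] dominates the gain of one iteration and the bound for nearby sites; 1/2 keeps it positive for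
   the logarithm. *)
pose m := Num.max 2^-1 (Num.max (p * phi p S) th).
have m0 : 0 < m by rewrite lt_max invr_gt0 ltr0n.
have m1 : m < 1 by rewrite !gt_max pS th1 !andbT invf_lt1// ltr1n.
(* Chosen so that a distance [N] costs exactly a factor [m]. *)
exists (- ln m / N); first by rewrite divr_gt0// oppr_gt0 ln_lt0// m0.
set c := - ln m / N.
have c0 : 0 < c by rewrite divr_gt0// oppr_gt0 ln_lt0// m0.
have cN : expR (- c * N) = m by rewrite /c mulNr divfK ?gt_eqF// opprK lnK.
move=> U s x y us; have [n] := ubnP #|` U|; elim: n => // n IH in U x *.
rewrite ltnS => Un.
have [->|xy] := eqVneq x y.
  rewrite subrr l1_0 mulr0 expR0 -[leRHS](Ex_cst (fun=> p) s 1 xpred0).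
  by apply: Ex_le => // w; exact: ind_le1.
(* Here [y] is within [N] of [x], so the target is at least [m]. *)
have [yS|yS] := boolP (y \in shiftS x S).
  apply: le_trans (Ex_conn_neq U p01 us xy) _; apply: (@le_trans _ _ m).
    by rewrite !le_max lexx !orbT.
  rewrite -cN ler_expR !mulNr lerN2 ler_wpM2l ?(ltW c0)//.
  rewrite mem_shiftS in yS; have := NS _ yS.
  by rewrite (_ : - x + y = - (x - y)) ?l1N// opprB addrC.
have xS : x \in shiftS x S by rewrite mem_shiftS addNr.
apply: le_trans (simon_lieb p01 us xS yS (fun v => expR_ge0 (- c * l1 (v - y))) _) _.
  by move=> U' v UU'; apply: IH; apply: leq_trans Un; exact: fproper_ltn_card.
rewrite (perm_big _ (touching_shift x S)) /= big_map.
under eq_bigl do rewrite crosses_shift.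
apply: (@le_trans _ _ (p * phi p S * (expR (- c * l1 (x - y)) / m))); last first.
  rewrite mulrCA ger_pMr ?expR_gt0// ler_pdivrMr// mul1r !le_max lexx !orbT//.
rewrite /phi mulr_sumr mulr_suml big_seq_cond [leRHS]big_seq_cond.
apply: ler_sum => e /andP[te ce].
rewrite inner_shift outer_shift; apply: ler_pM; rewrite ?expR_ge0//.
- by apply: mulr_ge0 => //; apply: Ex_ge0 => // w; exact: ind_ge0.
- by apply: ler_wpM2l => //; exact: Ex_conn_shift.
(* The outer end is within [N] of [x], so the triangle inequality loses at most a factor 1 / [m]. *)
have := NO _ te; have := l1D (x + outer S e - y) (- outer S e).
rewrite l1N (_ : _ + _ - _ - _ = x - y); last by rewrite addrAC addrK.
move=> h1 h2; have := ler_wpM2l (ltW c0) (le_trans h1 (lerD (lexx _) h2)).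
by rewrite -cN -expRN -expRD ler_expR; lra.
Qed.

End Decay.

(** * Sharpness of the percolation transition *)

Section Sharpness.
Variables (R : realType) (d : nat).
Implicit Types (w : config d) (e : bond d) (x y u v : site d) (U S L : {fset site d}).

Definition nonexit w L : {fset site d} := [fset x in L | `[< ~ exits w L x >]]%fset.

Lemma in_nonexit w L x : reflect (~ exits w L x) (x \in nonexit w L).
Proof.
rewrite !inE /=; apply: (iffP andP) => [[_ /asboolP]//|nx].
split; last exact/asboolP.
by apply/negPn/negP => xL; apply: nx; exact: exits_out.
Qed.

(** The set is found by exploring from outside [L], which inspects only bonds with an exiting end;
    the bonds inside the set stay unexplored. *)
Lemma nonexit_agree w w' L : (forall e, ~~ inside (nonexit w L) e -> w e = w' e) ->
  nonexit w' L = nonexit w L.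
Proof.
move=> ww'; apply/fsetP => x; apply/in_nonexit/in_nonexit; apply: contra_not.
  elim=> {x} [x xL|x y /open_edgeP[e j we] ey IH]; first exact: exits_out.
  apply: exits_step IH; apply/open_edgeP; exists e => //.
  rewrite -ww'// (joins_inside _ j) negb_and; apply/orP; right.
  by apply/in_nonexit => h; exact: h.
elim=> {x} [x xL|x y /open_edgeP[e j we] ey IH]; first exact: exits_out.
apply: (@exits_step _ _ _ _ y) => //; apply/open_edgeP; exists e => //.
rewrite ww'// (joins_inside _ j) negb_and; apply/orP; right.
by apply/in_nonexit => h; exact: h.
Qed.

Lemma nonexit_insens L S e : inside S e ->
  insens (fun w => ind (nonexit w L = S) : R) e.
Proof.
move=> Se; apply: insens_ind => w b wS; rewrite -[RHS]wS; apply: nonexit_agree => e'.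
by rewrite /upd wS; case: eqP => // ->; rewrite Se.
Qed.

Lemma exits_incr L x : incr (fun w => ind (exits w L x) : R).
Proof. by move=> w w' ww'; apply: ind_le; exact: exits_le. Qed.

Lemma phi_ge0 (p : R) S : 0 <= p <= 1 -> 0 <= phi p S.
Proof.
by move=> p01; apply: sumr_ge0 => e _; apply: Ex_ge0 => // w; exact: ind_ge0.
Qed.

Lemma phi_incr (p p' : R) S : 0 <= p -> p <= p' -> p' <= 1 -> phi p S <= phi p' S.
Proof.
move=> p0 pp' p'1; apply: ler_sum => e _; apply: Ex_incr_p.
- by move=> _; rewrite p0 (le_trans pp').
- by move=> _; rewrite p'1 (le_trans p0).
- by [].
- exact: conn_incr.
Qed.

(** Moves the boundary sum of every [S] in [L] to the bonds touching [L], the index set of Russo's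
    formula. *)
Lemma phi_le (p : R) S L : 0 <= p <= 1 -> (S `<=` L)%fset ->
  phi p S <= \sum_(e <- touching L | crosses S e)
    Ex (fun=> p) (touching L) (fun w => ind (conn w S 0 (inner S e))) xpred0.
Proof.
move=> p01 /fsubsetP SL.
have tSL e : touches S e -> touches L e.
  by rewrite /touches => /orP[]/SL ->; rewrite ?orbT.
rewrite /phi -big_filter -[leRHS]big_filter.
rewrite (perm_big [seq e <- touching L | crosses S e])/=; last first.
  apply: uniq_perm; rewrite ?filter_uniq ?uniq_touching// => e.
  rewrite !mem_filter; apply: andb_id2l => ce; rewrite !mem_touching.
  by rewrite (crosses_touches ce) tSL// crosses_touches.
apply: ler_sum => e _; apply: Ex_incl; rewrite ?uniq_touching//; first exact: conn_incr.
move=> e'; rewrite mem_touching => te'; apply: conn_insens; apply: contra te'.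
by move/inside_touches/tSL.
Qed.

(* Russo's formula gives the left-hand side as a derivative; a bond e is pivotal as
   soon as it leaves the set S of non-exiting points and its inner end is
   connected to 0 in S, and {nonexit = S} only depends on bonds not inside S. *)
Lemma russo_lower (p : R) L : 0 <= p <= 1 -> (forall S, 0 \in S -> 1 <= phi p S) ->
  1 - Ex (fun=> p) (touching L) (fun w => ind (exits w L 0)) xpred0 <=
  \sum_(e <- touching L) Ex (fun=> p) (touching L)
    (fun w => ind (exits (upd w e true) L 0) - ind (exits (upd w e false) L 0)) xpred0.
Proof.
move=> p01 phi1; have pp : @is_prob R (bond d) (fun=> p) by [].
set E := Ex (fun=> p) (touching L).
pose g S e w : R := ind (0 \in S) * (crosses S e)%:R * ind (conn w S 0 (inner S e)).
have nS w : (nonexit w L `<=` L)%fset by apply/fsubsetP => x; rewrite !inE => /andP[].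
apply: (@le_trans _ _ (\sum_(e <- touching L) E (fun w =>
    \sum_(S <- fpowerset L) ind (nonexit w L = S) * g S e w) xpred0)); last first.
  apply: ler_sum => e _; apply: Ex_le => // w.
  rewrite (@sum_ind_eq _ _ (fpowerset L) (fun S => g S e w)) ?fpowersetE//.
  have h0 : 0 <= ind (exits (upd w e true) L 0) - ind (exits (upd w e false) L 0) :> R.
    by rewrite subr_ge0; apply: exits_incr; exact: upd_le.
  rewrite /g; have [S0|S0] := pselect (0 \in nonexit w L); last by rewrite (indF S0) !mul0r.
  rewrite (indT S0) mul1r; have [ce|ce] := boolP (crosses _ e); last by rewrite mul0r.
  rewrite mul1r; have [c|nc] := pselect (conn w (nonexit w L) 0 (inner (nonexit w L) e));
    last by rewrite indF.
  have jn := joins_inner_outer (nonexit w L) e.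
  have eb : exits w L (outer (nonexit w L) e).
    by apply: contrapT => /in_nonexit; apply/negP; exact: crosses_outer.
  (* An open [e] would let its inner end exit. *)
  have we : w e = false.
    apply/negP => we; have /in_nonexit := crosses_inner ce; apply.
    by apply: exits_step eb; apply/open_edgeP; exists e.
  rewrite -we upd_id [X in _ <= _ - X]indF ?subr0; last exact/in_nonexit.
  have ww' : forall e', w e' ==> upd w e true e'.
    by move=> e'; rewrite /upd; case: ifP; rewrite ?implybT ?implybb.
  apply: ind_le => {}c.
  apply: (@conn_exits _ _ (nonexit w L) _ _ (inner (nonexit w L) e)).
    exact: conn_le c.
  apply: (@exits_step _ _ _ _ (outer (nonexit w L) e)); last exact: exits_le eb.
  by apply/open_edgeP; exists e; rewrite // /upd eqxx.
have indep S e : E (fun w => ind (nonexit w L = S) * g S e w) xpred0 =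
    E (fun w => ind (nonexit w L = S)) xpred0 * (ind (0 \in S) * (crosses S e)%:R *
     E (fun w => ind (conn w S 0 (inner S e))) xpred0).
  rewrite /E Ex_indep ?ExZ// => e' _; have [Se|Se] := boolP (inside S e').
    by left; exact: nonexit_insens.
  by right => w b; rewrite /g (conn_insens _ _ _ Se).
under eq_bigr => e _ do rewrite /E Ex_sum.
rewrite exchange_big /=.
(* Partition the event that 0 does not exit by the value of the non-exiting set. *)
have -> : 1 - E (fun w => ind (exits w L 0)) xpred0 =
    \sum_(S <- fpowerset L) E (fun w => ind (nonexit w L = S)) xpred0 * ind (0 \in S).
  under eq_bigr => S _ do rewrite mulrC -ExZ.
  rewrite -[1](Ex_cst (fun=> p) (touching L) 1 xpred0) -ExB -Ex_sum; apply: Ex_ext => w.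
  under eq_bigr => S _ do rewrite mulrC.
  rewrite (@sum_ind_eq _ _ (fpowerset L) (fun S => ind (0 \in S))) ?fpowersetE//.
  have [x0|x0] := pselect (exits w L 0).
    by rewrite (indT x0) subrr indF// => /in_nonexit.
  by rewrite (indF x0) subr0 indT//; exact/in_nonexit.
rewrite big_seq [leRHS]big_seq; apply: ler_sum => S; rewrite fpowersetE => SL.
rewrite /E in indep *.
under eq_bigr => e _ do rewrite indep.
rewrite -mulr_sumr; apply: ler_wpM2l; first by apply: Ex_ge0 => // w; exact: ind_ge0.
under eq_bigr => e _ do rewrite -mulrA.
rewrite -mulr_sumr; have [S0|S0] := pselect (0 \in S); last by rewrite indF ?mul0r.
rewrite (indT S0) mul1r; apply: le_trans (phi1 _ S0) _.
apply: le_trans (phi_le p01 SL) _.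
rewrite big_mkcond; apply: ler_sum => e _.
by case: ifP; rewrite ?mul1r ?mul0r.
Qed.

(** With g(r) the exit probability, the hypothesis gives g' >= 1 - g between p and p'. The mean
    value theorem and monotonicity yield g(p') >= (p' - p)(1 - g(p')), which is solved for g(p'). *)
Lemma exits_lower (p p' : R) L : 0 <= p -> p < p' -> p' <= 1 ->
  (forall S, 0 \in S -> 1 <= p * phi p S) ->
  (p' - p) / (1 + (p' - p)) <=
  Ex (fun=> p') (touching L) (fun w => ind (exits w L 0)) xpred0.
Proof.
move=> p0 pp' p'1 phi1.
pose g (r : R) := Ex (fun=> r) (touching L) (fun w => ind (exits w L 0)) xpred0.
have dg (r : R) := Ex_derive (fun w => ind (exits w L 0) : R) xpred0 r (uniq_touching L).
have cg : {within `[p, p'], continuous g}.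
  by apply: derivable_within_continuous => r _; have := dg r; case.
have [r + gr] := MVT pp' (fun r _ => dg r) cg.
rewrite in_itv /= => /andP[pr rp'].
have r01 : 0 <= r <= 1 by rewrite !ltW// ?(le_lt_trans p0)// (lt_le_trans rp').
have phir S : 0 \in S -> 1 <= phi r S.
  move=> S0; have p1 : p <= 1 by rewrite ltW// (lt_le_trans pp').
  apply: le_trans (phi1 _ S0) _; case/andP: r01 => _ r1.
  by apply: le_trans (phi_incr S p0 (ltW pr) r1); rewrite ler_piMl// phi_ge0// p0.
have h := russo_lower L r01 phir; rewrite -/(g r) in h.
have grp : g r <= g p'.
  apply: Ex_incr_p; [|move=> _|move=> _|exact: exits_incr].
  - by move=> _.
  - by rewrite p'1 (le_trans p0)// ltW.
  - exact: ltW.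
have gp : 0 <= g p.
  by apply: Ex_ge0 => [_|w]; rewrite ?ind_ge0// p0 (le_trans (ltW pp')).
have dl : 0 < p' - p by rewrite subr_gt0.
have dl1 : 0 < 1 + (p' - p) by lra.
rewrite ler_pdivrMr// -/(g p').
have := ler_wpM2r (ltW dl) (le_trans (lerB (lexx 1) grp) h).
by rewrite -gr -/(g p') -/(g p); lra.
Qed.

End Sharpness.

(** * Infinite-volume percolation through finite-volume expectations *)

Section InfiniteVolume.
Variables (R : realType) (d : nat).
Implicit Types (w t : config d) (e : bond d) (r s : seq (bond d)).
Implicit Types (A : set (configs d)) (S L : {fset site d}).

Lemma measurable_bond e b : measurable ([set w | w e = b] : set (configs d)).
Proof.
have mT : measurable ([set w | w e] : set (configs d)).
  by apply: sub_sigma_algebra; exists e.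
case: b => //; rewrite [X in measurable X](_ : _ = ~` [set w : configs d | w e]).
  exact: measurableC.
by apply/seteqP; split => w /=; case: (w e).
Qed.

Definition cylinder r t : set (configs d) := [set w : config d | {in r, w =1 t}].

Lemma measurable_cylinder r t : measurable (cylinder r t).
Proof.
elim: r => [|e r IH].
  by rewrite [X in measurable X](_ : _ = setT)//; apply/seteqP; split.
rewrite [X in measurable X](_ : _ = [set w : config d | w e = t e] `&` cylinder r t).
  by apply: measurableI => //; exact: measurable_bond.
apply/seteqP; split => w /=.
  by move=> wt; split; [apply: wt; rewrite mem_head|move=> e' e'r; apply: wt; rewrite inE e'r orbT].
by move=> [we wt] e'; rewrite inE => /predU1P[->//|]; exact: wt.
Qed.

Definition determined r A := forall w w', {in r, w =1 w'} -> A w -> A w'.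

Lemma cylinder_split e r t A : e \notin r ->
  cylinder r t `&` A =
  (cylinder (e :: r) (upd t e true) `&` A) `|`
  (cylinder (e :: r) (upd t e false) `&` A).
Proof.
move=> er; have tr b e' : e' \in r -> upd t e b e' = t e'.
  by move=> e'r; rewrite /upd; case: eqP => // e'e; rewrite -e'e e'r in er.
apply/seteqP; split => w /=.
  move=> [wt Aw]; have H : {in e :: r, w =1 upd t e (w e)}.
    move=> e'; rewrite inE => /predU1P[->|e'r]; first by rewrite /upd eqxx.
    by rewrite tr// wt.
  by move: H; case: (w e) => H; [left|right].
move=> [|] [wt Aw]; split => // e' e'r; rewrite wt ?inE ?e'r ?orbT//; exact: tr.
Qed.

Lemma cylinder_determined r t A : determined r A ->
  cylinder r t `&` A = [set w : config d | {in r, w =1 t} /\ A t].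
Proof.
move=> Ar; apply/seteqP; split => w /= [wt Aw]; split => //; first exact: Ar Aw.
by apply: Ar Aw => e er; rewrite wt.
Qed.

Lemma measurable_cylinderI r s t A : uniq (s ++ r) -> determined (s ++ r) A ->
  measurable (cylinder r t `&` A).
Proof.
elim: s r t => [|e s IH] r t.
  move=> _ Ar; rewrite cylinder_determined//.
  have [At|nAt] := pselect (A t).
    rewrite [X in measurable X](_ : _ = cylinder r t).
      exact: measurable_cylinder.
    by apply/seteqP; split => w /=; [case|].
  by rewrite [X in measurable X](_ : _ = set0)//; apply/seteqP; split => w //= [].
rewrite cat_cons => us Ar.
have er : e \notin r by move: us; rewrite /= mem_cat negb_or => /andP[/andP[]].
have pE : perm_eq (e :: s ++ r) (s ++ e :: r) by rewrite -cat1s -(cat1s e r) perm_catCA.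
have us' : uniq (s ++ e :: r) by rewrite -(perm_uniq pE).
have As' : determined (s ++ e :: r) A.
  by move=> w w' ww'; apply: Ar => e'; rewrite (perm_mem pE); exact: ww'.
by rewrite (cylinder_split _ _ er); apply: measurableU; exact: IH.
Qed.

Variables (p : R) (P : probability (configs d) R).
Hypothesis bP : is_bernoulli_percolation p P.

Lemma P_cylinder r t : uniq r ->
  P (cylinder r t) = (\prod_(e <- r) (if t e then p else 1 - p))%:E.
Proof.
move=> ur; have := bP [fset e in r]%fset t.
rewrite (_ : [set w | _] = cylinder r t); last first.
  by apply/seteqP; split => w /= H e; have := H e; rewrite !inE.
move=> ->; congr (_%:E); apply: perm_big; apply: uniq_perm => // e.
by rewrite !inE.
Qed.

(** Reveal the bonds of [s] one at a time: each split moves a bond into the cylinder, whose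
    probability accumulates in the product over [r], in parallel with the recursion of [Ex]. *)
Lemma P_cylinderI r s t A : uniq (s ++ r) -> determined (s ++ r) A ->
  P (cylinder r t `&` A) =
  ((\prod_(e <- r) (if t e then p else 1 - p)) * Ex (fun=> p) s (fun w => ind (A w)) t)%:E.
Proof.
elim: s r t => [|e s IH] r t.
  move=> ur Ar; rewrite cylinder_determined//=.
  have [At|nAt] := pselect (A t).
    rewrite indT// mulr1 -P_cylinder//; congr (P _).
    by apply/seteqP; split => w /=; [case|].
  rewrite indF// mulr0 (_ : [set w | _] = set0) ?measure0//.
  by apply/seteqP; split => w //= [].
rewrite cat_cons => us Ar.
have er : e \notin r by move: us; rewrite /= mem_cat negb_or => /andP[/andP[]].
have pE : perm_eq (e :: s ++ r) (s ++ e :: r) by rewrite -cat1s -(cat1s e r) perm_catCA.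
have us' : uniq (s ++ e :: r) by rewrite -(perm_uniq pE).
have As' : determined (s ++ e :: r) A.
  by move=> w w' ww'; apply: Ar => e'; rewrite (perm_mem pE); exact: ww'.
rewrite (cylinder_split _ _ er) measureU; last 3 first.
- exact: measurable_cylinderI us' As'.
- exact: measurable_cylinderI us' As'.
- apply/seteqP; split => w //= -[[/(_ e (mem_head _ _)) + _] [/(_ e (mem_head _ _)) + _]].
  by rewrite /upd eqxx => ->.
rewrite [X in (X + _)%E]IH// [X in (_ + X)%E]IH// -EFinD; congr (_%:E).
rewrite !big_cons /upd eqxx /=.
have tr b : \prod_(j <- r) (if (if j == e then b else t j) then p else 1 - p) =
   \prod_(j <- r) (if t j then p else 1 - p).
  rewrite !big_seq; apply: eq_bigr => e' e'r; case: eqP => // e'e.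
  by rewrite -e'e e'r in er.
by rewrite !tr mulrDr !mulrA ![_ * p]mulrC ![_ * (1 - p)]mulrC.
Qed.

Lemma P_determined s A w0 : uniq s -> determined s A ->
  measurable A /\ P A = (Ex (fun=> p) s (fun w => ind (A w)) w0)%:E.
Proof.
move=> us As; have us0 : uniq (s ++ [::]) by rewrite cats0.
have As0 : determined (s ++ [::]) A by rewrite cats0.
have E : A = cylinder [::] w0 `&` A.
  by apply/seteqP; split => [w Aw|w []].
split; first by rewrite E; exact: measurable_cylinderI us0 As0.
by rewrite [LHS](congr1 P E) (P_cylinderI _ us0 As0) big_nil mul1r.
Qed.

(** Increasing finite sets that exhaust the lattice, taken from an enumeration of its sites. *)
Definition sites n : {fset site d} := [fset x in pmap (@choice.unpickle (site d)) (iota 0 n)]%fset.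

Lemma mem_sites n x : (choice.pickle x < n)%N -> x \in sites n.
Proof.
move=> xn; rewrite !inE /= mem_pmap; apply/mapP.
exists (choice.pickle x); last by rewrite choice.pickleK.
by rewrite mem_iota.
Qed.

Lemma sites_le m n : (m <= n)%N -> {subset sites m <= sites n}.
Proof.
move=> mn x; rewrite !inE /= !mem_pmap => /mapP[k km xk]; apply/mapP; exists k => //.
by move: km; rewrite !mem_iota !add0n /= => /leq_trans; apply.
Qed.

Lemma infinite_cluster w :
  infinite_set (Defs.cluster w 0) <-> forall n, exits w (sites n) 0.
Proof.
split=> [wi n|we].
  apply/exits_cluster; apply: contrapT => h; apply: wi.
  apply: (@sub_finite_set _ _ [set` sites n]); last exact: finite_fset.
  by move=> y yc; apply/negPn/negP => yn; apply: h; exists y.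
move=> /finite_fsetP[X cX].
pose n := (\max_(x <- X) choice.pickle x).+1.
have [y yn yc] := (exits_cluster _ _ _).1 (we n).
have yX : y \in X by rewrite cX in yc.
move/negP: yn; apply; apply: mem_sites; rewrite ltnS.
exact: leq_bigmax_seq.
Qed.

(** The events of leaving [sites n] decrease to the event of an infinite cluster, so a uniform lower
    bound survives by continuity from above. *)
Lemma infinite_cluster_gt0 (c : R) : 0 < c ->
  (forall L, c <= Ex (fun=> p) (touching L) (fun w => ind (exits w L 0)) xpred0) ->
  P [set w | infinite_set (Defs.cluster w 0)] <> 0%E.
Proof.
move=> c0 cE P0.
pose A n : set (configs d) := [set w | exits w (sites n) 0].
have dA n : determined (touching (sites n)) (A n).
  by move=> w w' ww' /=; apply: exits_agree => e te; apply: ww'; rewrite mem_touching.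
have [mA PA] : (forall n, measurable (A n)) /\ (forall n, P (A n) =
    (Ex (fun=> p) (touching (sites n)) (fun w => ind (A n w)) xpred0)%:E).
  by split=> n; have [] := P_determined xpred0 (uniq_touching _) (dA n).
have PI : P (\bigcap_n A n) = 0%E.
  rewrite -P0; congr (P _); apply/seteqP; split => w /= h.
    by apply/infinite_cluster => n; exact: h.
  by move=> n _; move/infinite_cluster : h; apply.
have : P \o A @ \oo --> P (\bigcap_n A n).
  apply: nonincreasing_cvg_mu => //.
  - by apply: le_lt_trans (probability_le1 P (mA 0%N)) _; rewrite ltry.
  - exact: bigcapT_measurable.
  - move=> m n mn; apply/subsetPset => w /=; apply: exits_le; last exact: sites_le.
    by move=> e; exact: implybb.
rewrite PI => cP; have : (c%:E <= 0)%E.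
  apply: cvge_ge cP; near=> n; rewrite /= PA lee_fin; exact: cE.
by rewrite lee_fin leNgt c0.
Unshelve. all: by end_near.
Qed.

End InfiniteVolume.

Section Subcritical.
Variables (R : realType) (d : nat).

(** Some q > p in the set defining p_c has no percolation. If [p * phi p S] were at least 1 for all
    [S] containing 0, [exits_lower] at q would make an infinite cluster likely enough to contradict
    this. *)
Lemma exists_phi_lt1 (p : R) : 0 <= p -> p < pc_bond R d ->
  exists2 S : {fset site d}, 0 \in S & p * phi p S < 1.
Proof.
move=> p0; rewrite /pc_bond; set A := [set q | _].
(* The empty set has supremum 0 by convention, which p >= 0 rules out. *)
have [->|/set0P A0] := eqVneq A set0; first by rewrite sup0 ltNge p0.
move=> /(sup_gt A0)[q [/andP[q0 q1] [P [bP P0]]] pq].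
apply: contrapT => nS.
have phi1 (S : {fset site d}) : 0 \in S -> 1 <= p * phi p S.
  by move=> S0; rewrite leNgt; apply/negP => h; apply: nS; exists S.
apply: (infinite_cluster_gt0 bP _ (fun L => exits_lower L p0 pq q1 phi1)) P0.
by rewrite divr_gt0 ?subr_gt0// ltr_wpDr ?subr_ge0 ?ltW.
Qed.

End Subcritical.

(** * Gibbs measures as tilted product measures *)

Section BondSum.
Variables (R : realType) (d : nat).
Implicit Types (e : bond d) (u v : site d) (L : {fset site d}) (X Y : seq (site d)).

Lemma sum_eq_mem X u : uniq X -> \sum_(x <- X) (x == u)%:R = (u \in X)%:R :> R.
Proof.
move=> uX; have [uIX|uX'] := boolP (u \in X).
  by rewrite (bigD1_seq u)//= eqxx big1 ?addr0// => x /negbTE ->.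
by rewrite big_seq big1// => x xX; case: eqP => // xu; rewrite -xu xX in uX'.
Qed.

Lemma tgt_neq e : tgt e != e.1.
Proof. by rewrite /tgt -subr_eq0 addrC addKr unitv_neq0. Qed.

Lemma joinsE e u v : (joins e u v)%:R =
  (u == e.1)%:R * (v == tgt e)%:R + (u == tgt e)%:R * (v == e.1)%:R :> R.
Proof.
rewrite -!natrM -natrD; congr (_%:R); rewrite !mulnb /joins [(v == e.1) && _]andbC.
by have := tgt_neq e; case: (u =P e.1) => [->|] //=; rewrite eq_sym => /negbTE -> /=;
  rewrite ?orbF ?addn0.
Qed.

(** Each bond is counted once per orientation compatible with [X] and [Y]; since [X] lies in [L],
    all these bonds touch [L]. *)
Lemma sum_nn L X Y (J : site d -> site d -> R) : uniq X -> uniq Y -> {subset X <= L} ->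
  (forall u v, J u v = J v u) ->
  \sum_(u <- X) \sum_(v <- Y | nn u v) J u v =
  \sum_(e <- touching L) J e.1 (tgt e) *
    ((e.1 \in X)%:R * (tgt e \in Y)%:R + (tgt e \in X)%:R * (e.1 \in Y)%:R).
Proof.
move=> uX uY XL JC.
have step u v : u \in X -> (if nn u v then J u v else 0) =
    \sum_(e <- touching L) J e.1 (tgt e) * (joins e u v)%:R.
  move=> uIX; case: nnP => [[e j]|nj]; last first.
    rewrite big1// => e _; case: (boolP (joins e u v)) => j; last by rewrite mulr0.
    by case: nj; exists e.
  rewrite (bigD1_seq e) ?uniq_touching//=; last first.
    by rewrite mem_touching (joins_touches _ j) XL.
  rewrite j mulr1 big1 ?addr0 => [|e' e'e].
    by case/orP : (j) => /andP[/eqP-> /eqP->].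
  case: (boolP (joins e' u v)) => j'; last by rewrite mulr0.
  by rewrite (joins_inj j' j) eqxx in e'e.
transitivity (\sum_(u <- X) \sum_(v <- Y) \sum_(e <- touching L) J e.1 (tgt e) * (joins e u v)%:R).
  rewrite !big_seq; apply: eq_bigr => u uIX; rewrite big_mkcond; apply: eq_bigr => v _.
  exact: step.
under eq_bigr => u _ do rewrite exchange_big.
rewrite exchange_big /=; apply: eq_bigr => e _.
under eq_bigr => u _.
  rewrite -mulr_sumr; under eq_bigr => v _ do rewrite joinsE.
  rewrite big_split /= -!mulr_sumr !sum_eq_mem//; over.
by rewrite -mulr_sumr big_split /= -!mulr_suml !sum_eq_mem.
Qed.

Lemma exbd_nn L u v : u \in L -> v \notin L -> nn u v -> v \in exbd L.
Proof.
move=> uL vL uv; rewrite in_exbd vL /=; apply/existsP.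
by exists [` uL]%fset.
Qed.

(** Ordered pairs count a bond inside [L] twice, hence the 1/2, and a bond to the exterior boundary
    once. *)
Lemma sum_touching L (J : site d -> site d -> R) : (forall u v, J u v = J v u) ->
  \sum_(e <- touching L) J e.1 (tgt e) =
  2^-1 * (\sum_(u <- L) \sum_(v <- L | nn u v) J u v) +
  \sum_(u <- L) \sum_(v <- exbd L | nn u v) J u v.
Proof.
move=> JC; rewrite !(@sum_nn L) ?fset_uniq// mulr_sumr -big_split /= !big_seq.
apply: eq_bigr => e; rewrite mem_touching => te.
have exbdF v : v \in L -> (v \in exbd L) = false by rewrite in_exbd => ->.
have jn : joins e e.1 (tgt e) by rewrite /joins !eqxx.
have n1 : nn e.1 (tgt e) by apply/nnP; exists e.
have n2 : nn (tgt e) e.1 by apply/nnP; exists e; rewrite joinsC.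
move: te; rewrite /touches; have [h1|h1] := boolP (e.1 \in L);
  have [h2|h2] := boolP (tgt e \in L) => //= _.
- by rewrite (exbdF _ h1) (exbdF _ h2) /=; field.
- by rewrite (exbdF _ h1) (exbd_nn h1 h2 n1) /=; field.
- by rewrite (exbdF _ h2) (exbd_nn h2 h1 n2) /=; field.
Qed.

End BondSum.

Section FiniteSum.
Variables (R : realType) (E : choiceType).
Implicit Types (q : E -> R) (s : seq E) (w t : E -> bool) (L : {fset E}).

Lemma Ex_prod q s (a : E -> bool -> R) w : uniq s ->
  Ex q s (fun v => \prod_(e <- s) a e (v e)) w =
  \prod_(e <- s) (q e * a e true + (1 - q e) * a e false).
Proof.
elim: s w => [|e s IH] w /=; first by rewrite !big_nil.
move=> /andP[es us]; rewrite big_cons -(IH w us).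
have H b : Ex q s (fun v => \prod_(e' <- e :: s) a e' (v e')) (upd w e b) =
    a e b * Ex q s (fun v => \prod_(e' <- s) a e' (v e')) w.
  rewrite (@Ex_ext _ _ _ _ _ (fun v => a e (v e) * \prod_(e' <- s) a e' (v e'))); last first.
    by move=> v; rewrite big_cons.
  rewrite (Ex_frozenM q (c := fun v => a e (v e))) => [|e' e's v c]; last first.
    by rewrite /upd; case: eqP => // ee'; rewrite ee' e's in es.
  rewrite /upd eqxx; congr (_ * _); apply: Ex_insens => v c.
  rewrite !big_seq; apply: eq_bigr => e' e's; rewrite /upd; case: eqP => // e'e.
  by rewrite -e'e e's in es.
by rewrite !H; ring.
Qed.

Definition extend t L (s : {ffun L -> bool}) : E -> bool :=
  fun x => if insub x is Some u then s u else t x.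

Lemma extend_val t L (s : {ffun L -> bool}) (u : L) : extend t s (val u) = s u.
Proof. by rewrite /extend valK. Qed.

Lemma extend_out t L (s : {ffun L -> bool}) x : x \notin L -> extend t s x = t x.
Proof. by move=> xL; rewrite /extend insubN. Qed.

Lemma Ex_ffun q L (g : (E -> bool) -> R) t :
  Ex q (enum_fset L) g t =
  \sum_(s : {ffun L -> bool}) (\prod_(u : L) (if s u then q (val u) else 1 - q (val u))) *
    g (extend t s).
Proof.
(* Insert a partition of unity over spin configurations: the product of the [a] selects the one that
   agrees with the integration variable on [L]. *)
pose a (s : {ffun L -> bool}) (x : E) (b : bool) : R := (b == extend t s x)%:R.
transitivity (Ex q (enum_fset L) (fun v =>
    \sum_(s : {ffun L -> bool}) g (extend t s) * \prod_(x <- enum_fset L) a s x (v x)) t).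
  apply: Ex_dep => v v' vv' vt v't.
  have -> : v = v'.
    apply/funext => x; have [xL|xL] := boolP (x \in enum_fset L); first exact: vv'.
    by rewrite vt// v't.
  pose s0 : {ffun L -> bool} := [ffun u => v' (val u)].
  have es0 : extend t s0 = v'.
    apply/funext => x; have [xL|xL] := boolP (x \in L).
      by rewrite -[x]/(val [` xL]%fset) extend_val ffunE.
    by rewrite extend_out// v't.
  rewrite (bigD1 s0)//= [X in _ + X]big1 ?addr0 => [|s ss0].
    by rewrite es0 big1 ?mulr1// => x _; rewrite /a es0 eqxx.
  have /existsP[u su] : [exists u, s u != s0 u].
    apply: contraNT ss0; rewrite negb_exists => /forallP h.
    by apply/eqP/ffunP => u; apply/eqP; have := h u; rewrite negbK.
  rewrite (big_rem (val u)) ?fsvalP//= /a extend_val.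
  by move: su; rewrite ffunE eq_sym => /negbTE ->; rewrite mul0r mulr0.
rewrite Ex_sum; apply: eq_bigr => s _.
rewrite ExZ Ex_prod ?fset_uniq// mulrC; congr (_ * _).
rewrite big_seq_fsetE /=; apply: eq_bigr => u _.
by rewrite /a extend_val; case: (s u) => /=; ring.
Qed.

End FiniteSum.

(** * From Gibbs measures to exit probabilities *)

Section Gibbs.
Variables (R : realType) (d : nat) (beta H : R) (L : {fset site d}) (h : L -> R).
Hypothesis beta_ge0 : 0 <= beta.
Implicit Types (eta : spins (exbd L)) (s : spins L) (u v : site d).

Definition bond_prob : R := 1 - expR (- (2 * beta)).

Lemma bond_prob_bounds : 0 <= bond_prob < 1.
Proof.
rewrite /bond_prob subr_ge0 gtrBl expR_gt0 andbT -expR0 ler_expR oppr_le0.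
by rewrite mulr_ge0.
Qed.

Definition site_field (x : site d) : R := if insub x is Some u then H * h u else 0.

(* probability of spin +1 in the product measure obtained for beta = 0 *)
Definition plus_prob (x : site d) : R :=
  expR (site_field x) / (expR (site_field x) + expR (- site_field x)).

Lemma plus_prob_bounds x : 0 < plus_prob x < 1.
Proof.
have h0 : 0 < expR (site_field x) + expR (- site_field x) by rewrite addr_gt0 ?expR_gt0.
by rewrite /plus_prob divr_gt0 ?expR_gt0// ltr_pdivrMr// mul1r ltrDl expR_gt0.
Qed.

Lemma plus_probE x b : (if b then plus_prob x else 1 - plus_prob x) =
  expR (site_field x * spin R b) / (expR (site_field x) + expR (- site_field x)).
Proof.
have h0 : expR (site_field x) + expR (- site_field x) != 0 by rewrite gt_eqF// addr_gt0 ?expR_gt0.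
rewrite /plus_prob; case: b; first by rewrite mulr1.
by rewrite mulrN1; field.
Qed.

Definition boundary eta : site d -> bool := fun x => if insub x is Some v then eta v else false.

Lemma gibbs_exponentE eta s :
  let t := extend (boundary eta) s in
  gibbs_exponent eta beta H h s =
  beta * \sum_(e <- touching L) spin R (t e.1) * spin R (t (tgt e)) +
  \sum_(u : L) site_field (val u) * spin R (s u).
Proof.
move=> t; rewrite (@sum_touching R d L (fun u v => spin R (t u) * spin R (t v))); last first.
  by move=> u v; rewrite mulrC.
have tv (u : L) : t (val u) = s u by exact: extend_val.
have tb (v : exbd L) : t (val v) = eta v.
  have vL : val v \notin L by have := fsvalP v; rewrite in_exbd => /andP[].
  by rewrite /t extend_out// /boundary valK.
rewrite mulrDr /gibbs_exponent; congr (_ * (_ * _) + _ * _ + _).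
- rewrite [RHS]big_seq_fsetE; apply: eq_bigr => u _ /=.
  by rewrite [RHS]big_seq_fsetE; apply: eq_big => v //= _; rewrite !tv.
- rewrite [RHS]big_seq_fsetE; apply: eq_bigr => u _ /=.
  by rewrite [RHS]big_seq_fsetE; apply: eq_big => v //= _; rewrite tv tb.
- by rewrite mulr_sumr; apply: eq_bigr => u _; rewrite /site_field valK mulrA.
Qed.

Lemma expR_spin b b' : expR (beta * (spin R b * spin R b')) =
  expR beta * (if b == b' then 1 else 1 - bond_prob).
Proof.
rewrite /bond_prob subKr; case: b; case: b' => /=;
  rewrite ?mulr1 -?expRD; congr (expR _); rewrite /spin; ring.
Qed.

(** The constant is the same for all boundary conditions and spins, so it cancels in the normalized
    measure. *)
Lemma gibbs_factor : exists2 K, 0 < K & forall eta s,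
  expR (gibbs_exponent eta beta H h s) =
  K * ((\prod_(u : L) (if s u then plus_prob (val u) else 1 - plus_prob (val u))) *
       weight bond_prob (touching L) (extend (boundary eta) s)).
Proof.
(* One factor exp(beta) per bond, and the normalization of [plus_prob] per site. *)
exists (expR beta ^+ size (touching L) *
    \prod_(u : L) (expR (site_field (val u)) + expR (- site_field (val u)))).
  apply: mulr_gt0; first by rewrite exprn_gt0 ?expR_gt0.
  by apply: prodr_gt0 => u _; rewrite addr_gt0 ?expR_gt0.
move=> eta s; rewrite gibbs_exponentE expRD mulr_sumr !expR_sum.
rewrite [X in _ = _ * X]mulrC [RHS]mulrACA; congr (_ * _).
  under eq_bigr => e _ do rewrite expR_spin.
  by rewrite big_split /= big_const_seq count_predT iter_mulr_1.
rewrite -big_split /=; apply: eq_bigr => u _; rewrite plus_probE [RHS]mulrCA mulfV ?mulr1//.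
by rewrite gt_eqF// addr_gt0 ?expR_gt0.
Qed.

Lemma sum_gibbs eta (phi : spins L -> R) (f : (site d -> bool) -> R) :
  (forall s, f (extend (boundary eta) s) = phi s) ->
  \sum_s phi s * gibbs eta beta H h s =
  spin_avg bond_prob plus_prob f (touching L) L (boundary eta).
Proof.
move=> fphi; have [K K0 KE] := gibbs_factor.
rewrite /spin_avg !Ex_ffun /gibbs.
under eq_bigr => s _ do rewrite KE mulrA.
rewrite -mulr_suml; under [X in _ / X = _]eq_bigr => s _ do rewrite KE.
rewrite -mulr_sumr; under eq_bigr => s _ do rewrite mulrCA.
rewrite -mulr_sumr invfM mulrACA mulfV ?gt_eqF// mul1r; congr (_ / _).
by apply: eq_bigr => s _; rewrite mulrCA fphi.
Qed.

Lemma marginal_dist (D : {fset site d}) (DL : (D `<=` L)%fset) eta eta' :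
  tv_dist (gibbs_marginal DL eta beta H h) (gibbs_marginal DL eta' beta H h) <=
  Ex (fun=> bond_prob) (touching L) (exits_event R L D) xpred0.
Proof.
apply/bigmax_leP; split=> [|A _].
  by apply: Ex_ge0 => [_|w]; rewrite ?ind_ge0//; have /andP[-> /ltW] := bond_prob_bounds.
(* The event [A] on the spins in [D], seen as a function of a full configuration. *)
pose f (t : site d -> bool) : R := ([ffun x : D => t (val x)] \in A)%:R.
have E et : \sum_(t in A) gibbs_marginal DL et beta H h t =
    spin_avg bond_prob plus_prob f (touching L) L (boundary et).
  rewrite -(@sum_gibbs _ (fun s => (Defs.restrict DL s \in A)%:R)) => [|s]; last first.
    rewrite /f; congr ((_ \in A)%:R); apply/ffunP => x; rewrite !ffunE.
    exact: (extend_val (boundary et) s (fincl DL x)).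
  rewrite /gibbs_marginal (exchange_big_dep predT)//=; apply: eq_bigr => s _.
  have [sA|sA] := boolP (Defs.restrict DL s \in A).
    rewrite (big_pred1 (Defs.restrict DL s)) ?mul1r// => t /=.
    by rewrite [RHS]eq_sym; case: eqP => [<-|]; rewrite ?sA ?andbF.
  rewrite mul0r big_pred0// => t; case: eqP => [<-|]; rewrite ?andbF// andbT.
  exact: negbTE.
rewrite !E; apply: spin_avg_dist; rewrite ?uniq_touching//.
- exact: bond_prob_bounds.
- exact: plus_prob_bounds.
- by move=> s; rewrite /f; case: (_ \in A); rewrite lexx ler01.
- move=> s s' ss'; rewrite /f; congr ((_ \in A)%:R); apply/ffunP => x; rewrite !ffunE.
  by apply: ss'; exact: fsvalP.
Qed.

Lemma exits_event_le (D : {fset site d}) (w : config d) : (D `<=` L)%fset ->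
  exits_event R L D w <=
  \sum_(x <- exbd D) \sum_(y <- exbd L) ind (conn w (L `|` exbd L)%fset x y).
Proof.
move=> /fsubsetP DL; set V := (L `|` exbd L)%fset.
have s0 x : 0 <= \sum_(y <- exbd L) ind (conn w V x y) :> R.
  by apply: sumr_ge0 => y _; exact: ind_ge0.
rewrite /exits_event; have [[z zD ez]|nz] := pselect (exists2 z, z \in D & exits w L z); last first.
  by rewrite indF// sumr_ge0.
(* Stop the path at its first site off [L]: that site is in [exbd L], and the path so far stays in
   [V]. *)
have [y yL zy] : exists2 y, y \in exbd L & conn w V z y.
  have zL := DL _ zD; elim: ez zL {zD} => {z} [z /negbTE -> //|z t zt _ IH zL].
  have zV : z \in V by rewrite in_fsetU zL.
  have [tL|tL] := boolP (t \in L).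
    by have [y yL ty] := IH tL; exists y => //; exact: conn_step zt ty.
  have tb : t \in exbd L.
    have [e j _] := open_edgeP _ _ _ zt.
    by apply: exbd_nn zL tL _; apply/nnP; exists e.
  exists t => //; apply: conn_step zt _ => //.
  by apply: conn_refl; rewrite in_fsetU tb orbT.
have yD : y \notin D.
  by move: yL; rewrite in_exbd => /andP[+ _]; apply: contra; exact: DL.
(* The last exit from [D] lands in [exbd D], where the connection to [exbd L] begins. *)
have [a [b [aD bD _ ab cb]]] := conn_last_exit zy zD yD.
have bDD : b \in exbd D.
  have [e j _] := open_edgeP _ _ _ ab.
  by apply: exbd_nn aD bD _; apply/nnP; exists e.
have c : conn w V b y.
  by apply: conn_le cb => [e|x]; [exact: implybb|rewrite in_fsetD => /andP[]].
rewrite indT; last by exists z.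
apply: (@le_trans _ _ (\sum_(y <- exbd L) ind (conn w V b y))).
  by rewrite -(indT c); apply: (@ler_term_sum _ _ _ predT (fun y => ind (conn w V b y))).
by apply: (@ler_term_sum _ _ _ predT (fun x => \sum_(y <- exbd L) ind (conn w V x y))).
Qed.

End Gibbs.

Lemma bond_prob_lt_pc (R : realType) (d : nat) (beta : R) :
  (beta%:E < betaP R d)%E -> bond_prob beta < pc_bond R d.
Proof.
have /andP[_ p1] := pc_bond_ge0_le1 R d.
rewrite /betaP /bond_prob ltrBlDr -ltrBlDl.
have : 0 <= 1 - pc_bond R d by rewrite subr_ge0.
(* If p_c = 1, [betaP] is infinite, and it remains to see that an exponential is positive. *)
rewrite le_eqVlt => /orP[/eqP <- _|pc0]; first by rewrite expR_gt0.
rewrite lne_EFin// -EFinN -EFinM lte_fin => h.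
by rewrite -[ltLHS]lnK// ltr_expR; lra.
Qed.

Theorem theorem4 (R : realType) (d : nat) (hd : (0 < d)%N) (beta : R)
    (beta_ge0 : 0 <= beta) (beta_lt : (beta%:E < betaP R d)%E) :
  exists C3 : R, 0 < C3 /\
    forall (H : R) (H_gt0 : 0 < H) (D L : {fset site d})
      (DL : (D `<=` L)%fset) (h : L -> R),
    sup [set tv_dist (gibbs_marginal DL etas.1 beta H h)
                     (gibbs_marginal DL etas.2 beta H h)
        | etas in [set: spins (exbd L) * spins (exbd L)]]
    <= \sum_(x <- exbd D) \sum_(y <- exbd L)
         expR (- C3 * eucl_dist R x y).
Proof.
have p01 := bond_prob_bounds beta_ge0; have /andP[p0 p1] := p01.
(* [S], and hence the decay rate, is fixed by [beta] and the dimension, before the field and the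
   volume appear. *)
have [S S0 pS] := exists_phi_lt1 p0 (bond_prob_lt_pc beta_lt).
have [c c0 cE] := conn_exp_decay p01 S0 pS.
exists c; split=> // H _ D L DL h; apply: ge_sup.
  (* Bounding a supremum by an upper bound takes a nonempty set; a constant boundary condition
     provides an element. *)
  by exists (tv_dist (gibbs_marginal DL [ffun=> true] beta H h)
    (gibbs_marginal DL [ffun=> true] beta H h)); exists ([ffun=> true], [ffun=> true]).
move=> _ [[eta eta'] _ <-] /=; apply: le_trans (marginal_dist H h beta_ge0 DL eta eta') _.
have pp : @is_prob R (bond d) (fun=> bond_prob beta) by move=> _; rewrite p0 ltW.
apply: le_trans (Ex_le _ _ pp (fun w => @exits_event_le R d L D w DL)) _.
rewrite Ex_sum; apply: ler_sum => x _; rewrite Ex_sum; apply: ler_sum => y _.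
apply: le_trans (cE _ _ _ _ (uniq_touching L)) _.
by rewrite ler_expR !mulNr lerN2 ler_wpM2l ?(ltW c0)// eucl_le_l1.
Qed.
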